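(* Let $d_1,\ldots,d_N$ be positive integers with $d_1+\cdots+d_N=d$, and let $T\prec T'$ be admissible topologies on $\{1,\ldots,N\}$. Then the configuration space $\mathcal{X}_T$ with the projection $\pi_{T,T'}:\mathcal{X}_T\to\mathcal{X}_{T'}$ is locally bilipschitz homeomorphic to a vector bundle over $\mathcal{X}_{T'}$ with fibers of dimension $\sum_{i=1}^N\sum_{j\in T'(i)\setminus T(i)}d_id_j$. That is, there are a vector bundle $p:\mathcal{V}\to\mathcal{X}_{T'}$ with fibers of this dimension and a homeomorphism $\varphi:\mathcal{V}\to\mathcal{X}_T$ such that $\varphi$ and $\varphi^{-1}$ are locally Lipschitz and $\pi_{T,T'}\circ\varphi=p$.
   Context: For $I\subset\{1,\ldots,N\}$ put $d(I)=\sum_{i\in I}d_i$. For a topology $T$ on $\{1,\ldots,N\}$, $T(i)$ denotes the atom of $i$ (the smallest open set containing $i$). $T$ is admissible if $T(i)\subset\{i,i+1,\ldots,N\}$ for all $i$. $T\prec T'$ means $T(i)\subset T'(i)$ for all $i$ (so $T'\subset T$). $\mathcal{X}_T$ is the space of sequences $(x_I)_{I\in T}$ such that $x_I$ is a $d(I)$-dimensional subspace of $\mathbb{R}^d$ for each $I\in T$, $x_{I\cup J}=x_I+x_J$ and $x_{I\cap J}=x_I\cap x_J$ for all $I,J\in T$. It is endowed with the distance coming from its natural embedding in a product of Grassmannian manifolds. $\pi_{T,T'}$ is the projection which forgets the subspaces $x_I$ for $I\in T\setminus T'$. A vector bundle over $\mathcal{X}_{T'}$ is here understood as a sub-bundle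 of a product $\mathcal{X}_{T'}\times E$, with $E$ a finite-dimensional normed space, metrized by the sum of the distance in $\mathcal{X}_{T'}$ and the norm distance in $E$. *)

(* Defs.v *)
From HB Require Import structures.
From mathcomp Require Import all_boot all_order all_algebra.
From mathcomp Require Import all_classical all_reals.
From mathcomp Require Import topology normedtype.
From mathcomp Require Import ring.

Set Implicit Arguments.
Unset Strict Implicit.
Unset Printing Implicit Defensive.

Import Order.TTheory GRing.Theory Num.Theory.
Import numFieldNormedType.Exports.

Local Open Scope classical_set_scope.
Local Open Scope ring_scope.

Section FiniteTopology.
Variable N : nat.

(* The set {1, ..., N} is 'I_N = {0, ..., N.-1}.  As it is finite, closure    *)
(* under binary unions gives closure under arbitrary ones.                    *)
Definition is_topology (T : {set {set 'I_N}}) : bool :=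
  [&& finset.set0 \in T, [set: 'I_N]%SET \in T &
      [forall I in T, forall J in T, (I :|: J \in T) && (I :&: J \in T)]].

Record finTopology := FinTopology {
  opens :> {set {set 'I_N}};
  opensP : is_topology opens }.

Implicit Types T : finTopology.

Definition atom T (i : 'I_N) : {set 'I_N} :=
  (\bigcap_(I in opens T | i \in I) I)%SET.

Definition admissible T : Prop :=
  forall i j : 'I_N, j \in atom T i -> (i <= j)%N.

Definition prec T T' : Prop := forall i, atom T i \subset atom T' i.

Lemma open0 T : finset.set0 \in opens T.
Proof. by case/and3P: (opensP T). Qed.

Lemma openT T : [set: 'I_N]%SET \in opens T.
Proof. by case/and3P: (opensP T). Qed.

Lemma openU_subproof T I J :
  I \in opens T -> J \in opens T -> I :|: J \in opens T.
Proof.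
move=> TI TJ; case/and3P: (opensP T) => _ _ /forallP/(_ I)/implyP/(_ TI).
by move=> /forallP/(_ J)/implyP/(_ TJ) /andP[].
Qed.

Lemma openI_subproof T I J :
  I \in opens T -> J \in opens T -> I :&: J \in opens T.
Proof.
move=> TI TJ; case/and3P: (opensP T) => _ _ /forallP/(_ I)/implyP/(_ TI).
by move=> /forallP/(_ J)/implyP/(_ TJ) /andP[].
Qed.

Lemma mem_atom T i : i \in atom T i.
Proof. by apply/finset.bigcapP => I /andP[]. Qed.

Lemma atom_open T i : atom T i \in opens T.
Proof.
apply: (big_ind (fun I => I \in opens T)); last by move=> I /andP[].
- exact: openT.
- by move=> I J; exact: openI_subproof.
Qed.

Lemma atom_min T (I : {set 'I_N}) i :
  I \in opens T -> i \in I -> atom T i \subset I.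
Proof. by move=> TI iI; apply: finset.bigcap_inf; rewrite TI. Qed.

Lemma prec_opens T T' : prec T T' -> {subset opens T' <= opens T}.
Proof.
move=> TT' I T'I.
have -> : I = (\bigcup_(i in I) atom T i)%SET.
  apply/eqP; rewrite finset.eqEsubset; apply/andP; split.
    by apply/fintype.subsetP => i iI; apply/finset.bigcupP; exists i;
      rewrite ?mem_atom.
  apply/finset.bigcupsP => i iI.
  exact: (fintype.subset_trans (TT' i) (atom_min T'I iI)).
apply: (big_ind (fun J => J \in opens T)) => [|J K|i _].
- exact: open0.
- exact: openU_subproof.
- exact: atom_open.
Qed.

Definition openSet T := {I : {set 'I_N} | I \in opens T}.

Definition openU T (I J : openSet T) : openSet T :=
  exist _ (sval I :|: sval J) (openU_subproof (svalP I) (svalP J)).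

Definition openI T (I J : openSet T) : openSet T :=
  exist _ (sval I :&: sval J) (openI_subproof (svalP I) (svalP J)).

Definition openIncl T T' (TT' : prec T T') (I : openSet T') : openSet T :=
  exist _ (sval I) (prec_opens TT' (svalP I)).

End FiniteTopology.

Section Frobenius.
Variable R : rcfType.
Implicit Types m n : nat.

Definition frobenius m n (A : 'M[R]_(m, n)) : R :=
  Num.sqrt (\sum_i \sum_j A i j ^+ 2).

Lemma frobenius0 m n : frobenius (0 : 'M[R]_(m, n)) = 0.
Proof.
rewrite /frobenius big1 ?sqrtr0// => i _; rewrite big1// => j _.
by rewrite mxE expr0n.
Qed.

Lemma frobeniusN m n (A : 'M[R]_(m, n)) : frobenius (- A) = frobenius A.
Proof.
congr Num.sqrt; apply: eq_bigr => i _; apply: eq_bigr => j _.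
by rewrite mxE sqrrN.
Qed.

Lemma frobenius_eq0 m n (A : 'M[R]_(m, n)) : frobenius A = 0 -> A = 0.
Proof.
move=> /eqP; rewrite sqrtr_eq0 => A0.
have sq0 i j : 0 <= A i j ^+ 2 by exact: sqr_ge0.
have row0 i : 0 <= \sum_j A i j ^+ 2 by exact: sumr_ge0.
have /eqP : \sum_i \sum_j A i j ^+ 2 = 0 by apply/le_anti; rewrite A0 sumr_ge0.
rewrite psumr_eq0// => /allP Ai; apply/matrixP => i j; rewrite mxE.
have := Ai i (mem_index_enum _); rewrite psumr_eq0//= => /allP/(_ j).
by rewrite mem_index_enum sqrf_eq0 => /(_ isT)/eqP.
Qed.

Lemma frobenius_ge0 m n (A : 'M[R]_(m, n)) : 0 <= frobenius A.
Proof. exact: sqrtr_ge0. Qed.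

Lemma frobeniusD m n (A B : 'M[R]_(m, n)) :
  frobenius (A + B) <= frobenius A + frobenius B.
Proof.
pose dot (X Y : 'M[R]_(m, n)) := \sum_i \sum_j X i j * Y i j.
have frobE X : frobenius X ^+ 2 = dot X X.
  have ge0 : 0 <= \sum_i \sum_j X i j ^+ 2.
    by do 2 apply: sumr_ge0 => ? _; exact: sqr_ge0.
  rewrite (sqr_sqrtr ge0); apply: eq_bigr => i _; apply: eq_bigr => j _.
  exact: expr2.
have dot_lin s t X Y :
    dot (s *: X + t *: Y) (s *: X + t *: Y) =
    s ^+ 2 * dot X X + s * t * dot X Y *+ 2 + t ^+ 2 * dot Y Y.
  rewrite -mulrnAr /dot -sumrMnl !mulr_sumr -!big_split/=.
  apply: eq_bigr => i _; rewrite -sumrMnl !mulr_sumr -!big_split/=.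
  apply: eq_bigr => j _; rewrite !mxE.
  ring.
have dotAB : dot A B <= frobenius A * frobenius B.
  have [A0|An0] := eqVneq (frobenius A) 0.
    rewrite A0 mul0r (frobenius_eq0 A0) /dot big1// => i _.
    by rewrite big1// => j _; rewrite mxE mul0r.
  have [B0|Bn0] := eqVneq (frobenius B) 0.
    rewrite B0 mulr0 (frobenius_eq0 B0) /dot big1// => i _.
    by rewrite big1// => j _; rewrite mxE mulr0.
  have ab0 : 0 < frobenius A * frobenius B.
    by rewrite mulr_gt0// lt_def ?An0 ?Bn0 frobenius_ge0.
  rewrite -subr_ge0 -(pmulr_rge0 _ ab0) -(pmulrn_lge0 _ (ltn0Sn 1)).
  have := sqr_ge0 (frobenius (frobenius B *: A + (- frobenius A) *: B)).
  rewrite frobE dot_lin -!frobE sqrrN.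
  set a := frobenius A; set b := frobenius B => ge0; congr (0 <= _): ge0.
  ring.
rewrite -(@ler_pXn2r _ 2) ?nnegrE ?addr_ge0 ?frobenius_ge0//.
have := dot_lin 1 1 A B; rewrite !scale1r frobE => ->.
by rewrite !expr1n !mul1r sqrrD -!frobE lerD2r lerD2l lerMn2r dotAB.
Qed.

End Frobenius.

Section Grassmannian.
Variables (R : realType) (n : nat).
Implicit Types U V : {vspace 'rV[R]_n}.

Definition basis_mx U : 'M[R]_(\dim U, n) := \matrix_(i < \dim U) (vbasis U)`_i.

(* Matrix of the orthogonal projection onto U, for the standard inner product *)
(* and acting on row vectors by v |-> v *m orthoproj U.                       *)
Definition orthoproj U : 'M[R]_n :=
  let B := basis_mx U in B^T *m invmx (B *m B^T) *m B.

Lemma mul_basis_mx U (c : 'rV[R]_(\dim U)) :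
  c *m basis_mx U = \sum_i c 0 i *: (vbasis U)`_i.
Proof. by rewrite mulmx_sum_row; apply: eq_bigr => i _; rewrite rowK. Qed.

Lemma mul_basis_mx_in U (c : 'rV[R]_(\dim U)) : c *m basis_mx U \in U.
Proof.
rewrite mul_basis_mx; apply: memv_suml => i _; apply: memvZ.
by apply: vbasis_mem; rewrite mem_nth// size_tuple.
Qed.

Lemma gram_unit U : basis_mx U *m (basis_mx U)^T \in unitmx.
Proof.
set B := basis_mx U.
rewrite -row_free_unit -kermx_eq0; apply/rowV0P => c /sub_kermxP.
rewrite mulmxA => cBB.
have cB0 : c *m B = 0.
  have : (c *m B) *m (c *m B)^T = 0 by rewrite trmx_mul mulmxA cBB mul0mx.
  move: (c *m B) => w /matrixP/(_ 0 0); rewrite !mxE => /eqP.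
  under eq_bigr => i _ do rewrite mxE.
  rewrite psumr_eq0 => [/allP w0|i _]; last by rewrite -expr2 sqr_ge0.
  apply/rowP => i; rewrite [RHS]mxE; apply/eqP; rewrite -sqrf_eq0 expr2.
  exact: (w0 i (mem_index_enum _)).
apply/rowP => i; rewrite [RHS]mxE.
move: cB0; rewrite mul_basis_mx => c0.
have /freeP := basis_free (vbasisP U).
by move=> /(_ (fun i => c 0 i) c0 i).
Qed.

Lemma orthoprojP U (v : 'rV[R]_n) : (v \in U) = (v *m orthoproj U == v).
Proof.
apply/idP/eqP => [vU|<-]; last by rewrite /orthoproj mulmxA mul_basis_mx_in.
have -> : v = (\row_i coord (vbasis U) i v) *m basis_mx U.
  rewrite mul_basis_mx {1}(coord_vbasis vU).
  by apply: eq_bigr => i _; rewrite mxE.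
by rewrite /orthoproj /= !mulmxA -[X in X *m invmx _]mulmxA mulmxK// gram_unit.
Qed.

Lemma orthoproj_inj : injective orthoproj.
Proof. by move=> U V UV; apply/vspaceP => v; rewrite !orthoprojP UV. Qed.

(* The chordal distance between subspaces.  On each Grassmannian of R^n, it   *)
(* is bilipschitz equivalent to the gap distance (operator norm) and to the   *)
(* distance of any Riemannian metric.                                         *)
Definition grassmann_dist U V : R := frobenius (orthoproj U - orthoproj V).

Lemma grassmann_distxx U : grassmann_dist U U = 0.
Proof. by rewrite /grassmann_dist subrr frobenius0. Qed.

Lemma grassmann_dist_eq0 U V : grassmann_dist U V = 0 -> U = V.
Proof. by move=> /frobenius_eq0/subr0_eq/orthoproj_inj. Qed.

Lemma grassmann_distC U V : grassmann_dist U V = grassmann_dist V U.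
Proof. by rewrite /grassmann_dist -frobeniusN opprB. Qed.

Lemma grassmann_dist_triangle V U W :
  grassmann_dist U W <= grassmann_dist U V + grassmann_dist V W.
Proof.
rewrite /grassmann_dist (le_trans _ (frobeniusD _ _))//.
by rewrite addrA subrK.
Qed.

End Grassmannian.

Section ConfigurationSpace.
Variables (R : realType) (n N : nat) (d : 'I_N -> nat).

Definition is_config (T : finTopology N)
    (x : {ffun openSet T -> {vspace 'rV[R]_n}}) : bool :=
  [&& [forall I, \dim (x I) == (\sum_(i in sval I) d i)%N],
      [forall I, forall J, x (openU I J) == (x I + x J)%VS] &
      [forall I, forall J, x (openI I J) == (x I :&: x J)%VS]].

Record config (T : finTopology N) := Config {
  config_ffun :> {ffun openSet T -> {vspace 'rV[R]_n}};
  configP : is_config config_ffun }.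

HB.instance Definition _ T := [isSub for @config_ffun T].
HB.instance Definition _ T := [Choice of config T by <:].

Section ConfigMetric.
Variable T : finTopology N.
Implicit Types x y z : config T.

Definition config_dist x y : R := \sum_(I : openSet T) grassmann_dist (x I) (y I).

Let config_distxx x : config_dist x x = 0.
Proof. by rewrite /config_dist big1// => I _; exact: grassmann_distxx. Qed.

Let config_dist_eq0 x y : config_dist x y = 0 -> x = y.
Proof.
move=> /eqP; rewrite psumr_eq0 => [/allP xy|I _]; last exact: frobenius_ge0.
apply/val_inj/ffunP => I; apply/grassmann_dist_eq0/eqP.
exact: (xy I (mem_index_enum _)).
Qed.

Let config_distC x y : config_dist x y = config_dist y x.
Proof. by apply: eq_bigr => I _; exact: grassmann_distC. Qed.

Let config_dist_triangle y x z :
  config_dist x z <= config_dist x y + config_dist y z.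
Proof.
rewrite /config_dist -big_split/=; apply: ler_sum => I _.
exact: grassmann_dist_triangle.
Qed.

HB.instance Definition _ := isMetric.Build R (config T)
  config_distxx config_dist_eq0 config_distC config_dist_triangle.

End ConfigMetric.

Lemma config_proj_subproof T T' (TT' : prec T T') (x : config T) :
  is_config [ffun I : openSet T' => x (openIncl TT' I)].
Proof.
case/and3P: (configP x) => /forallP xd /forallP xU /forallP xI.
apply/and3P; split; apply/forallP => I; rewrite ?ffunE.
- exact: xd.
- apply/forallP => J; rewrite !ffunE.
  rewrite -(eqP (forallP (xU _) _)); apply/eqP; congr (x _).
  exact/val_inj.
- apply/forallP => J; rewrite !ffunE.
  rewrite -(eqP (forallP (xI _) _)); apply/eqP; congr (x _).
  exact/val_inj.
Qed.

Definition config_proj T T' (TT' : prec T T') (x : config T) : config T' :=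
  Config (config_proj_subproof TT' x).

End ConfigurationSpace.

#[short(type="normedVectType")]
HB.structure Definition NormedVector (R : numFieldType) :=
  { E of NormedModule R E & Vector R E }.

HB.instance Definition _ (R : realType) (m k : nat) :=
  NormedModule.on 'M[R]_(m, k).

Section VectorBundle.
Variables (R : realType) (X : metricType R) (E : normedVectType R).
Variable V : X -> {vspace E}.

Record totalSpace := Total {
  total_pair : X * E;
  totalP : total_pair.2 \in V total_pair.1 }.

HB.instance Definition _ := [isSub for total_pair].
HB.instance Definition _ := [Choice of totalSpace by <:].

Definition bundle_proj (p : totalSpace) : X := (total_pair p).1.
Definition bundle_vec (p : totalSpace) : E := (total_pair p).2.

Definition total_dist (p q : totalSpace) : R :=
  mdist (bundle_proj p) (bundle_proj q) + `|bundle_vec p - bundle_vec q|.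

Let total_distxx p : total_dist p p = 0.
Proof. by rewrite /total_dist mdistxx subrr normr0 addr0. Qed.

Let total_dist_eq0 p q : total_dist p q = 0 -> p = q.
Proof.
move=> /eqP; rewrite paddr_eq0 ?mdist_ge0// normr_eq0 subr_eq0.
move=> /andP[/eqP/mdist_positivity pq1 /eqP pq2]; apply/val_inj => /=.
move: pq1 pq2; rewrite /bundle_proj /bundle_vec.
by case: (total_pair p) (total_pair q) => [? ?] [? ?]/= -> ->.
Qed.

Let total_distC p q : total_dist p q = total_dist q p.
Proof. by rewrite /total_dist metric_sym distrC. Qed.

Let total_dist_triangle q p r :
  total_dist p r <= total_dist p q + total_dist q r.
Proof.
by rewrite /total_dist addrACA lerD ?ler_distD// metric_triangle.
Qed.

HB.instance Definition _ := isMetric.Build R totalSpace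
  total_distxx total_dist_eq0 total_distC total_dist_triangle.

(* (x, a) |-> (x, h x a) is a homeomorphism from U x R^k to the part of the   *)
(* total space over U, linear on fibers, with inverse (x, e) |-> (x, g x e).  *)
Definition local_trivialization (k : nat) (U : set X)
    (h : X -> 'rV[R]_k -> E) (g : X -> E -> 'rV[R]_k) : Prop :=
  [/\ forall x, U x -> linear (h x),
      forall x, U x ->
        [/\ forall a, h x a \in V x,
            cancel (h x) (g x) &
            {in V x, cancel (g x) (h x)}],
      {within [set p : X * 'rV[R]_k | U p.1], continuous (fun p => h p.1 p.2)} &
      {within [set p : X * E | U p.1 /\ p.2 \in V p.1],
         continuous (fun p => g p.1 p.2)}].

Definition vector_bundle (k : nat) : Prop :=
  (forall x, \dim (V x) = k) /\
  (forall x : X, exists U : set X, nbhs x U /\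
     exists h g, local_trivialization (k := k) U h g).

End VectorBundle.

Section Maps.
Variables (R : realType) (X Y : metricType R).

Definition homeomorphism (f : X -> Y) (g : Y -> X) : Prop :=
  [/\ cancel f g, cancel g f, continuous f & continuous g].

Definition locally_lipschitz (f : X -> Y) : Prop :=
  forall x : X, exists U : set X, nbhs x U /\
    exists k : R, forall y z, U y -> U z -> mdist (f y) (f z) <= k * mdist y z.

End Maps.

(* Main.v *)
From HB Require Import structures.
Require Import Defs.
From mathcomp Require Import all_boot all_order all_algebra.
From mathcomp Require Import all_classical all_reals.
From mathcomp Require Import topology normedtype.
From mathcomp Require Import ring lra.

(** Let [p] be the splitting of R^n into the summands
      E_i(x) = orthogonal complement of x_(T'(i) \ {i}) in x_(T'(i))
    attached to a configuration [x] of the coarser space.  By admissibility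
    [T'(i) \ {i}] is open, E_i(x) has dimension d_i, and x_I is the direct sum
    of the E_i(x) with i in I (config_splitting_frame, fixvs_config_splitting).

    A configuration [y] over [x] is a refinement of [x].  Its own splitting is
    triangular with respect to the one of [x], because both have the same flag
    of subspaces of index {k, k+1, ...}, a set which is open for an admissible
    topology.  A vector has a leading component for this flag, and comparing
    leading components shows that y_(T(i)) is a complement of the sum of the E_j
    with j outside T(i) (transversal).  Projecting E_i onto this sum along
    y_(T(i)) and changing the sign yields a linear map a_i, the only one whose
    graph over E_i lies in y_(T(i)).  As y_(T(i)) is contained in x_(T'(i)), the
    values of a_i lie in the sum of the E_j for j in T'(i) \ T(i).  Conversely,
    all families of such maps occur: their sum A is nilpotent, since j > i for
    these j, so 1 + A is invertible and transports the subspaces spanned by the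
    E_i, with i in an open set of T, to a configuration [y] over [x].  The fiber
    over [x] is thus the vector space
      V(x) = sum of Hom(E_i, E_j) over i and j in T'(i) \ T(i),
    viewed inside the space of all matrices (hom_bundle); its dimension and its
    local triviality are read off on frames adapted to the E_i (moving_frame).

    The regularity of both maps has one source: sums, products, transposes and
    inverses of locally Lipschitz matrix-valued functions are locally Lipschitz,
    and every object is given by such an expression in the orthogonal projectors
    which define the distance: the splitting of a configuration
    (config_splitting), the coordinate A of [y] (chart), and the orthogonal
    projector onto the image of an oblique projector (orthoproj_oblique).

    Vectors are rows and matrices act on the right. *)

Set Implicit Arguments.
Unset Strict Implicit.
Unset Printing Implicit Defensive.

Import Order.TTheory GRing.Theory Num.Theory.
Import numFieldNormedType.Exports.

Local Open Scope classical_set_scope.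
Local Open Scope ring_scope.

(** * Norms of matrices *)

Section MatrixNorm.
Variable R : realType.

Lemma entry_le_norm m n (A : 'M[R]_(m, n)) i j : `|A i j| <= `|A|.
Proof.
rewrite [leRHS]/Num.norm/= mx_normrE.
exact: (le_bigmax_cond 0 (fun ij : 'I_m * 'I_n => `|A ij.1 ij.2|)
  (erefl (xpredT (i, j)))).
Qed.

Lemma norm_le_entries m n (A : 'M[R]_(m, n)) c :
  0 <= c -> (forall i j, `|A i j| <= c) -> `|A| <= c.
Proof.
move=> c0 Ac; rewrite [leLHS]/Num.norm/= mx_normrE.
by apply/bigmax_leP; split => // -[i j] _; exact: Ac.
Qed.

Lemma norm_mulmx_le m n p (A : 'M[R]_(m, n)) (B : 'M[R]_(n, p)) :
  `|A *m B| <= n%:R * (`|A| * `|B|).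
Proof.
apply: norm_le_entries => [|i j]; first by rewrite !mulr_ge0.
rewrite mxE (le_trans (ler_norm_sum _ _ _))//.
rewrite mulr_natl -[X in _ *+ X]card_ord -sumr_const ler_sum// => k _.
by rewrite normrM ler_pM// entry_le_norm.
Qed.

Lemma norm_trmx_le m n (A : 'M[R]_(m, n)) : `|A^T| <= `|A|.
Proof. by apply: norm_le_entries => // i j; rewrite mxE entry_le_norm. Qed.

Lemma norm_le_frobenius m n (A : 'M[R]_(m, n)) : `|A| <= frobenius A.
Proof.
apply: norm_le_entries => [|i j]; first exact: frobenius_ge0.
rewrite -sqrtr_sqr ler_wsqrtr// (bigD1 i)//= (bigD1 j)//= -addrA lerDl.
rewrite addr_ge0// sumr_ge0// => *; first exact: sqr_ge0.
by rewrite sumr_ge0// => *; exact: sqr_ge0.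
Qed.

Lemma frobenius_le_norm m n (A : 'M[R]_(m, n)) :
  frobenius A <= Num.sqrt (m * n)%:R * `|A|.
Proof.
rewrite -[X in _ * X]ger0_norm// -sqrtr_sqr -sqrtrM// ler_wsqrtr//.
have -> : (m * n)%:R * `|A| ^+ 2 = \sum_(i < m) \sum_(j < n) `|A| ^+ 2.
  by rewrite !sumr_const !card_ord -mulrnA mulr_natl mulnC.
do 2 apply: ler_sum => ? _; rewrite -[leLHS]real_normK ?num_real//.
by rewrite lerXn2r ?nnegrE// entry_le_norm.
Qed.

(** A solution of [v *m B = 0] satisfies [v = v *m (A - B) *m invmx A], so it
    vanishes as soon as the right-hand side is a contraction. *)
Lemma unitmx_perturb n (A B : 'M[R]_n) : A \in unitmx ->
  n%:R * (n%:R * (`|A - B| * `|invmx A|)) < 1 -> B \in unitmx.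
Proof.
move=> Au AB1; rewrite -row_free_unit -kermx_eq0; apply/rowV0P => v.
move=> /sub_kermxP vB0.
have vE : v = v *m ((A - B) *m invmx A).
  by rewrite mulmxA mulmxBr vB0 subr0 mulmxK.
apply/eqP; rewrite -normr_eq0; apply: contraTT AB1 => v0.
have v_gt0 : 0 < `|v| by rewrite lt_def v0 normr_ge0.
rewrite -leNgt -(ler_pM2r v_gt0) mul1r {1}vE (le_trans (norm_mulmx_le _ _))//.
rewrite mulrCA mulrC ler_wpM2r// ler_wpM2l// norm_mulmx_le//.
Qed.

Lemma norm_invmxB_le n (A B : 'M[R]_n) : A \in unitmx -> B \in unitmx ->
  `|invmx A - invmx B| <=
  n%:R * n%:R * (`|invmx A| * `|B - A| * `|invmx B|).
Proof.
move=> Au Bu.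
have -> : invmx A - invmx B = invmx A *m ((B - A) *m invmx B).
  by rewrite mulmxA mulmxBr mulmxBl mulVmx// mul1mx mulmxK.
rewrite (le_trans (norm_mulmx_le _ _))// -!mulrA ler_wpM2l// mulrCA.
by rewrite ler_wpM2l// norm_mulmx_le.
Qed.

Lemma cvg_mx_entries (X : Type) (F : set_system X) m n
    (f : X -> 'M[R]_(m, n)) (l : 'M[R]_(m, n)) : Filter F ->
  (forall i j, (fun x => f x i j) @ F --> l i j) -> f @ F --> l.
Proof.
move=> FF fl; apply/cvgrPdist_le => e e0.
have : \forall x \near F, forall ij : 'I_m * 'I_n,
    `|l ij.1 ij.2 - f x ij.1 ij.2| <= e.
  apply: filter_forall => -[i j].
  by have /cvgrPdist_le/(_ e e0) := fl i j.
apply: filterS => x fx; apply: norm_le_entries => [|i j]; first exact: ltW.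
by rewrite !mxE; exact: (fx (i, j)).
Qed.

Lemma cvg_mulmx (X : Type) (F : set_system X) m n p
    (f : X -> 'M[R]_(m, n)) (g : X -> 'M[R]_(n, p))
    (a : 'M[R]_(m, n)) (b : 'M[R]_(n, p)) : Filter F ->
  f @ F --> a -> g @ F --> b -> (fun x => f x *m g x) @ F --> a *m b.
Proof.
move=> FF fa gb; apply: cvg_mx_entries => i j; rewrite mxE.
under eq_fun do rewrite mxE.
apply: cvg_big => [|k _]; first exact: add_continuous.
apply: cvgM.
  exact: (cvg_comp _ _ fa (@coord_continuous _ _ _ i k a)).
exact: (cvg_comp _ _ gb (@coord_continuous _ _ _ k j b)).
Qed.

End MatrixNorm.

(** * Locally Lipschitz matrix-valued functions *)

Section LocalLipschitz.
Variables (R : realType) (X : metricType R).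

(** Pointwise, because inverses of matrices are controlled only where the matrix
    is invertible. *)
Definition loclip_at (V : normedModType R) (f : X -> V) (x : X) : Prop :=
  exists U : set X, nbhs x U /\
    exists k : R, forall y z, U y -> U z -> `|f y - f z| <= k * mdist y z.

Lemma loclip_at_bounded (V : normedModType R) (f : X -> V) x : loclip_at f x ->
  exists (U : set X) (k M : R), [/\ nbhs x U, 0 <= k, 0 <= M,
    (forall y z, U y -> U z -> `|f y - f z| <= k * mdist y z) &
    forall y, U y -> `|f y| <= M].
Proof.
move=> [U [xU [k fk]]]; exists (U `&` ball x 1), `|k|, (`|f x| + `|k|).
have fk' y z : U y -> U z -> `|f y - f z| <= `|k| * mdist y z.
  move=> Uy Uz; rewrite (le_trans (fk y z Uy Uz))// ler_wpM2r ?mdist_ge0//.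
  exact: ler_norm.
split => //; first 1 last.
- by rewrite addr_ge0.
- by move=> y z [Uy _] [Uz _]; exact: fk'.
- move=> y [Uy]; rewrite ballEmdist/= => xy.
  rewrite -[f y](subrK (f x)) addrC (le_trans (ler_normD _ _))// lerD2l//.
  rewrite (le_trans (fk' y x Uy (nbhs_singleton xU)))//.
  by rewrite ler_piMr// metric_sym ltW.
- by apply: filterI => //; exact: nbhsx_ballx.
Qed.

Lemma loclip_at_cvg (V : normedModType R) (f : X -> V) x :
  loclip_at f x -> f @ x --> f x.
Proof.
move=> /loclip_at_bounded[U [k [M [xU k0 _ fk _]]]].
apply/cvgrPdist_le => e e0.
have k1 : 0 < k + 1 by rewrite ltr_wpDl.
have : \forall y \near x, U y /\ ball x (e / (k + 1)) y.
  by apply: filterI => //; apply: nbhsx_ballx; rewrite divr_gt0.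
apply: filterS => y [Uy]; rewrite ballEmdist/= => /ltW xy.
rewrite (le_trans (fk x y (nbhs_singleton xU) Uy))//.
rewrite (@le_trans _ _ ((k + 1) * mdist x y))//.
  by rewrite ler_wpM2r ?mdist_ge0// lerDl.
by rewrite mulrC -ler_pdivlMr.
Qed.

Lemma loclip_at_cst (V : normedModType R) (c : V) x : loclip_at (fun=> c) x.
Proof.
exists setT; split; first exact: filterT.
by exists 0 => y z _ _; rewrite subrr normr0 mul0r.
Qed.

Lemma loclip_atD (V : normedModType R) (f g : X -> V) x :
  loclip_at f x -> loclip_at g x -> loclip_at (fun y => f y + g y) x.
Proof.
move=> [U [xU [k fk]]] [U' [xU' [k' gk]]].
exists (U `&` U'); split; first exact: filterI.
exists (k + k') => y z [Uy Uy'] [Uz Uz'].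
by rewrite opprD addrACA (le_trans (ler_normD _ _))// mulrDl lerD ?fk ?gk.
Qed.

Lemma loclip_atN (V : normedModType R) (f : X -> V) x :
  loclip_at f x -> loclip_at (fun y => - f y) x.
Proof.
move=> [U [xU [k fk]]]; exists U; split => //; exists k => y z Uy Uz.
by rewrite -opprD normrN fk.
Qed.

Lemma loclip_atB (V : normedModType R) (f g : X -> V) x :
  loclip_at f x -> loclip_at g x -> loclip_at (fun y => f y - g y) x.
Proof. by move=> fx gx; apply: loclip_atD => //; exact: loclip_atN. Qed.

Lemma loclip_at_sum (V : normedModType R) (I : Type) (r : seq I) (P : pred I)
    (f : I -> X -> V) x :
  (forall i, P i -> loclip_at (f i) x) ->
  loclip_at (fun y => \sum_(i <- r | P i) f i y) x.
Proof.
move=> fx; elim: r => [|i r IHr].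
  rewrite (_ : (fun=> _) = fun=> 0); first exact: loclip_at_cst.
  by apply/funext => y; rewrite big_nil.
have [Pi|nPi] := boolP (P i); last first.
  rewrite (_ : (fun=> _) = fun y => \sum_(i <- r | P i) f i y)//.
  by apply/funext => y; rewrite big_cons (negPf nPi).
rewrite (_ : (fun=> _) = fun y => f i y + \sum_(i <- r | P i) f i y).
  by apply: loclip_atD => //; exact: fx.
by apply/funext => y; rewrite big_cons Pi.
Qed.

Lemma loclip_at_trmx m n (f : X -> 'M[R]_(m, n)) x :
  loclip_at f x -> loclip_at (fun y => (f y)^T) x.
Proof.
move=> [U [xU [k fk]]]; exists U; split => //; exists k => y z Uy Uz.
by rewrite -linearB/= (le_trans (norm_trmx_le _))// fk.
Qed.

Lemma loclip_atM m n p (f : X -> 'M[R]_(m, n)) (g : X -> 'M[R]_(n, p)) x :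
  loclip_at f x -> loclip_at g x -> loclip_at (fun y => f y *m g y) x.
Proof.
move=> /loclip_at_bounded[U [k [M [xU k0 M0 fk fM]]]].
move=> /loclip_at_bounded[U' [k' [M' [xU' k'0 M'0 gk gM]]]].
exists (U `&` U'); split; first exact: filterI.
exists (n%:R * (k * M') + n%:R * (M * k')) => y z [Uy Uy'] [Uz Uz'].
have -> : f y *m g y - f z *m g z =
    (f y - f z) *m g y + f z *m (g y - g z).
  by rewrite mulmxBl mulmxBr addrA subrK.
rewrite (le_trans (ler_normD _ _))// mulrDl lerD//.
  rewrite (le_trans (norm_mulmx_le _ _))// -mulrA ler_wpM2l// mulrAC.
  by rewrite ler_pM ?fk ?gM.
rewrite (le_trans (norm_mulmx_le _ _))// -!mulrA ler_wpM2l//.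
by rewrite ler_pM ?fM ?gk.
Qed.

Lemma loclip_at_near_unit n (f : X -> 'M[R]_n) x :
  loclip_at f x -> f x \in unitmx -> \forall y \near x, f y \in unitmx.
Proof.
move=> /loclip_at_cvg/cvgrPdist_lt fx fxu.
pose c := n%:R * n%:R * `|invmx (f x)|.
have c0 : 0 <= c by rewrite !mulr_ge0.
have c1 : 0 < c + 1 by rewrite ltr_wpDl.
have := fx (c + 1)^-1; rewrite invr_gt0 => /(_ c1).
apply: filterS => y fxy; apply: unitmx_perturb fxu _.
rewrite [ltLHS](_ : _ = c * `|f x - f y|); last first.
  by rewrite /c -!mulrA; congr (_ * (_ * _)); rewrite mulrC.
rewrite (@le_lt_trans _ _ ((c + 1) * `|f x - f y|))//.
  by rewrite ler_wpM2r// lerDl.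
by rewrite mulrC -ltr_pdivlMr// mul1r.
Qed.

(** The estimate of [norm_invmxB_le] is used twice: against the fixed matrix
    [f x], it bounds the inverses near [x]; between two nearby points, it then
    gives the Lipschitz estimate. *)
Lemma loclip_at_invmx n (f : X -> 'M[R]_n) x :
  loclip_at f x -> f x \in unitmx -> loclip_at (fun y => invmx (f y)) x.
Proof.
move=> fx fxu; have fu := loclip_at_near_unit fx fxu.
have invB := @norm_invmxB_le R n.
set c := `|invmx (f x)|; set N := (n%:R * n%:R : R).
have N0 : 0 <= N by rewrite mulr_ge0.
have c0 : 0 <= c by exact: normr_ge0.
have Nc1 : 0 < N * c * 2 + 1 by rewrite ltr_wpDl// !mulr_ge0.
have nearx : \forall y \near x, `|f x - f y| < (N * c * 2 + 1)^-1.
  by have /cvgrPdist_lt := loclip_at_cvg fx; apply; rewrite invr_gt0.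
(* The bound 2 c holds as |f x - f y| N c <= 1/2 absorbs half of the norm of
   the inverse of f y. *)
have invM y : f y \in unitmx -> `|f x - f y| < (N * c * 2 + 1)^-1 ->
    `|invmx (f y)| <= c * 2.
  move=> yu xy; have := invB _ _ fxu yu.
  rewrite -/c -/N -normrN opprB -[`|f y - _|]normrN opprB => le1.
  have le2 : N * (c * `|f x - f y| * `|invmx (f y)|) <= 2^-1 * `|invmx (f y)|.
    rewrite !mulrA ler_wpM2r// -[leRHS]mulr1 ler_pdivlMl// mulrC mulrAC.
    rewrite (@le_trans _ _ ((N * c * 2 + 1) * `|f x - f y|))//.
      by rewrite ler_wpM2r// lerDl.
    by rewrite -ler_pdivlMl// mulr1 ltW.
  have le3 : `|invmx (f y)| <= c + 2^-1 * `|invmx (f y)|.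
    rewrite -{1}[invmx (f y)](subrK (invmx (f x))) addrC.
    by rewrite (le_trans (ler_normD _ _))// lerD2l (le_trans le1).
  by lra.
case: fx => U [xU [k fk]].
exists [set y | [/\ U y, f y \in unitmx &
                  `|f x - f y| < (N * c * 2 + 1)^-1]]; split.
  by apply: filterS3 xU fu nearx.
exists (N * (c * 2 * k * (c * 2))) => y z [Uy yu xy] [Uz zu xz].
rewrite (le_trans (invB _ _ yu zu))// -/N.
have -> : N * (c * 2 * k * (c * 2)) * mdist y z =
    N * (c * 2 * (k * mdist y z) * (c * 2)) by ring.
rewrite ler_wpM2l//.
have Mf : `|f z - f y| <= k * mdist y z by rewrite distrC fk.
have My := invM _ yu xy; have Mz := invM _ zu xz.
by apply: ler_pM => //; [rewrite mulr_ge0|exact: ler_pM].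
Qed.

End LocalLipschitz.

Lemma loclip_at_comp (R : realType) (X Y : metricType R) (V : normedModType R)
    (f : Y -> V) (g : X -> Y) x (k : R) :
  (forall y z, mdist (g y) (g z) <= k * mdist y z) ->
  loclip_at f (g x) -> loclip_at (f \o g) x.
Proof.
move=> gk [U [gxU [c fc]]].
have k1 : 0 < `|k| + 1 by rewrite ltr_wpDl.
have gk1 y z : mdist (g y) (g z) <= (`|k| + 1) * mdist y z.
  rewrite (le_trans (gk y z))// ler_wpM2r ?mdist_ge0//.
  by rewrite (le_trans (ler_norm _))// lerDl.
exists (g @^-1` U); split.
  have /nbhs_ballP[e/= e0 eU] := gxU.
  apply/nbhs_ballP; exists (e / (`|k| + 1)) => /=; first by rewrite divr_gt0.
  move=> y; rewrite ballEmdist/= => xy; apply: eU; rewrite ballEmdist/=.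
  by rewrite (le_lt_trans (gk1 _ _))// mulrC -ltr_pdivlMr.
exists (`|c| * (`|k| + 1)) => y z Uy Uz.
rewrite (le_trans (fc _ _ Uy Uz))//.
rewrite (@le_trans _ _ (`|c| * mdist (g y) (g z)))//.
  by rewrite ler_wpM2r ?mdist_ge0// ler_norm.
by rewrite -mulrA ler_wpM2l.
Qed.

(** * Splittings of a space into a direct sum *)

Section FixedVectors.
Variables (F : fieldType) (n : nat).

Lemma unitmx_row0 (M : 'M[F]_n) :
  (forall v : 'rV_n, v *m M = 0 -> v = 0) -> M \in unitmx.
Proof.
move=> M0; rewrite -row_free_unit -kermx_eq0; apply/rowV0P => v.
by move=> /sub_kermxP; exact: M0.
Qed.

Lemma dim_coords k (E : vectType F) (U : {vspace E})
    (f : 'rV[F]_k -> E) (g : E -> 'rV[F]_k) :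
  linear f -> (forall a, f a \in U) -> cancel f g -> {in U, cancel g f} ->
  \dim U = k.
Proof.
move=> f_lin fU fK gK.
pose fl : {linear 'rV[F]_k -> E} :=
  HB.pack f (GRing.isLinear.Build F 'rV[F]_k E *:%R f f_lin).
have -> : U = limg (linfun fl).
  apply/eqP; rewrite eqEsubv; apply/andP; split; apply/subvP => v.
    by move=> vU; rewrite -(gK v vU) -[f _]/(fl _) -(lfunE fl) memv_img// memvf.
  by move=> /memv_imgP[a _ ->]; rewrite lfunE; exact: fU.
rewrite limg_dim_eq; first by rewrite dimvf dim_matrix [LHS]mul1n.
apply/eqP; rewrite -subv0; apply/subvP => a; rewrite memv_cap memv_ker memv0.
rewrite lfunE/= => /andP[_ /eqP a0].
by rewrite -(fK a) a0 -(linear0 fl) /= fK.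
Qed.

(** For an idempotent this is the image, but membership is an equation, so that
    inclusions of subspaces become identities between matrices. *)
Definition fixvs (Q : 'M[F]_n) : {vspace 'rV[F]_n} :=
  fixedSpace (linfun (mulmxr Q)).

Lemma fixvsP Q v : reflect (v *m Q = v) (v \in fixvs Q).
Proof. by apply: (iffP fixedSpaceP); rewrite lfunE. Qed.

Lemma fixvs_sub (P Q : 'M[F]_n) : P *m Q = P -> (fixvs P <= fixvs Q)%VS.
Proof.
by move=> PQ; apply/subvP => v /fixvsP vP; apply/fixvsP; rewrite -vP -mulmxA PQ.
Qed.

End FixedVectors.

Section Splittings.
Variables (F : fieldType) (n N : nat).
Implicit Types (p q : 'I_N -> 'M[F]_n) (I J : {set 'I_N}).

Definition psum p I : 'M[F]_n := \sum_(i in I) p i.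

(** A direct sum decomposition of the space, given by its projectors; the
    subspaces [x_I] of a configuration are images of [psum p I]. *)
Definition splitting p : Prop :=
  (forall i j, p i *m p j = if i == j then p i else 0) /\ \sum_i p i = 1%:M.

Lemma psum0 p : psum p finset.set0 = 0.
Proof. by rewrite /psum big_set0. Qed.

Lemma psum1 p i : psum p [set i]%SET = p i.
Proof. by rewrite /psum big_set1. Qed.

Lemma psumD p I J : psum p I = psum p (I :&: J) + psum p (I :\: J).
Proof. by rewrite /psum (big_setID J). Qed.

Section OneSplitting.
Variable p : 'I_N -> 'M[F]_n.
Hypothesis p_split : splitting p.

Lemma psumT : psum p [set: 'I_N]%SET = 1%:M.
Proof. by rewrite -p_split.2 /psum; apply: eq_bigl => i; rewrite inE. Qed.

Lemma psumC I : psum p I + psum p (~: I) = 1%:M.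
Proof.
by rewrite -psumT (psumD _ [set: 'I_N]%SET I) finset.setTI finset.setTD.
Qed.

Lemma mulmx_psum i I : p i *m psum p I = if i \in I then p i else 0.
Proof.
rewrite mulmx_sumr; under eq_bigr do rewrite p_split.1.
rewrite -big_mkcondr/=; case: ifPn => iI.
  rewrite (bigD1 i) ?iI ?eqxx//= big1 ?addr0// => j.
  by move=> /andP[/andP[_ /eqP ->]]; rewrite eqxx.
by rewrite big1// => j /andP[jI /eqP ij]; rewrite ij jI in iI.
Qed.

Lemma psumM I J : psum p I *m psum p J = psum p (I :&: J).
Proof.
rewrite mulmx_suml; under eq_bigr do rewrite mulmx_psum.
by rewrite -big_mkcondr/=; apply: eq_bigl => i; rewrite inE.
Qed.

Lemma psumMl I J : I \subset J -> psum p I *m psum p J = psum p I.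
Proof. by move=> /finset.setIidPl IJ; rewrite psumM IJ. Qed.

Lemma psum_mulmx I i : psum p I *m p i = if i \in I then p i else 0.
Proof.
rewrite -{1}(psum1 p i) psumM; case: ifPn => iI.
  by rewrite (finset.setIidPr _) ?psum1// finset.sub1set.
rewrite (_ : I :&: [set i]%SET = finset.set0) ?psum0//.
by apply/finset.setP => j; rewrite !inE; case: eqP => [->|_];
  rewrite ?(negPf iI) ?andbF.
Qed.

Lemma row_psum m (A : 'M[F]_(n, m)) : A = \sum_i p i *m A.
Proof. by rewrite -mulmx_suml p_split.2 mul1mx. Qed.

Lemma fixvs_psumI I J :
  fixvs (psum p (I :&: J)) = (fixvs (psum p I) :&: fixvs (psum p J))%VS.
Proof.
apply/vspaceP => v; rewrite memv_cap; apply/idP/andP.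
  by move=> vIJ; split; move: v vIJ; apply/subvP/fixvs_sub/psumMl;
    [exact: finset.subsetIl|exact: finset.subsetIr].
move=> [/fixvsP vI /fixvsP vJ]; apply/fixvsP.
by rewrite -psumM mulmxA vI vJ.
Qed.

Lemma fixvs_psumU I J :
  fixvs (psum p (I :|: J)) = (fixvs (psum p I) + fixvs (psum p J))%VS.
Proof.
apply/eqP; rewrite eqEsubv; apply/andP; split; last first.
  by rewrite subv_add !fixvs_sub ?psumMl ?finset.subsetUl ?finset.subsetUr.
apply/subvP => v /fixvsP <-.
rewrite (psumD p _ I) finset.setUK finset.setDUl finset.setDv finset.set0U.
rewrite mulmxDr memv_add//; apply/fixvsP; rewrite -mulmxA psumMl//.
exact: finset.subsetDl.
Qed.

End OneSplitting.
End Splittings.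

(** * Frames adapted to a splitting *)

Section Blocks.
Variables (F : fieldType) (n N : nat) (blk : 'I_n -> 'I_N).
Implicit Types (B : 'M[F]_n) (p : 'I_N -> 'M[F]_n) (I : {set 'I_N}).

(** [blk a] is the block that contains the index [a], so that a matrix whose
    rows are sorted by [blk] consists of one basis for each summand. *)
Definition blockproj i : 'M[F]_n := diag_mx (\row_a (blk a == i)%:R).

Lemma block_splitting : splitting blockproj.
Proof.
split=> [i j|].
  rewrite /blockproj mulmx_diag; case: eqVneq => [<-|ij].
    congr diag_mx; apply/rowP => a; rewrite !mxE.
    by case: eqP => _; rewrite ?mulr1 ?mulr0.
  rewrite [X in diag_mx X](_ : _ = 0) ?linear0//.
  apply/rowP => a; rewrite !mxE; case: (eqVneq _ i) => [->|_].
    by rewrite (negPf ij) mulr0.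
  by rewrite mul0r.
rewrite -linear_sum/= [X in diag_mx X](_ : _ = const_mx 1) ?diag_const_mx//.
apply/rowP => a; rewrite summxE [RHS]mxE (bigD1 (blk a))//= mxE eqxx.
by rewrite big1 ?addr0// => i; rewrite mxE eq_sym => /negPf->.
Qed.

Lemma psum_block I : psum blockproj I = diag_mx (\row_a (blk a \in I)%:R).
Proof.
rewrite /psum -linear_sum/=; congr diag_mx; apply/rowP => a.
rewrite summxE mxE; under eq_bigr do rewrite mxE.
have [aI|aI] := boolP (blk a \in I).
  rewrite (bigD1 (blk a))//= eqxx big1 ?addr0// => i.
  by rewrite eq_sym => /andP[_ /negPf->].
rewrite big1// => i iI; case: eqP => // ai.
by rewrite ai iI in aI.
Qed.

Definition frame_splitting B i : 'M[F]_n := invmx B *m blockproj i *m B.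

Lemma frame_splittingP B : B \in unitmx -> splitting (frame_splitting B).
Proof.
move=> Bu; split=> [i j|].
  rewrite /frame_splitting !mulmxA mulmxK// -[_ *m _ *m blockproj j]mulmxA.
  by rewrite block_splitting.1; case: eqP => // _; rewrite mulmx0 mul0mx.
rewrite /frame_splitting -mulmx_suml -mulmx_sumr block_splitting.2 mulmx1.
by rewrite mulVmx.
Qed.

Lemma psum_frame B I :
  psum (frame_splitting B) I = invmx B *m psum blockproj I *m B.
Proof. by rewrite /psum mulmx_sumr mulmx_suml. Qed.

Lemma dim_frame B I : B \in unitmx ->
  \dim (fixvs (psum (frame_splitting B) I)) = #|[pred a | blk a \in I]|.
Proof.
move=> Bu; set A := [pred a | blk a \in I].
pose E : 'M[F]_(#|A|, n) := rowsub enum_val 1%:M.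
have EE : E *m E^T = 1%:M.
  apply/matrixP => s t; rewrite !mxE (bigD1 (enum_val s))//= !mxE eqxx mul1r.
  rewrite big1 ?addr0 => [|a].
    by rewrite (inj_eq enum_val_inj) eq_sym.
  by rewrite !mxE eq_sym => /negPf->; rewrite mul0r.
have EtE : E^T *m E = psum blockproj I.
  rewrite psum_block; apply/matrixP => a b; rewrite !mxE.
  under eq_bigr do rewrite !mxE.
  have [aA|aA] := boolP (a \in A).
    rewrite (bigD1 (enum_rank_in aA a))//= enum_rankK_in// eqxx mul1r big1.
      by rewrite addr0 (_ : blk a \in I).
    move=> s sa; case: eqP => [sa'|_]; last by rewrite mul0r.
    by case/eqP: sa; rewrite -(enum_valK_in aA s) sa'.
  rewrite (negPf aA : (blk a \in I) = false) mul0rn big1// => s _.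
  case: eqP => [sa|_]; last by rewrite mul0r.
  by move: aA; rewrite -sa enum_valP.
apply: (@dim_coords _ _ _ _ (mulmxr (E *m B))
  (fun v => v *m invmx B *m E^T)).
- exact: linearP.
- move=> a; apply/fixvsP => /=; rewrite psum_frame -EtE !mulmxA mulmxK//.
  by rewrite -[X in X *m E]mulmxA EE mulmx1.
- by move=> a /=; rewrite mulmxA mulmxK// -mulmxA EE mulmx1.
- move=> v /fixvsP; rewrite psum_frame -EtE /= !mulmxA; exact.
Qed.

(** Characterizes the frames of a splitting by an identity without inverses,
    which is easier to verify for a frame that varies. *)
Lemma frame_splitting_conj p B : B \in unitmx ->
  (forall i, B *m p i = blockproj i *m B) <->
  (forall i, p i = frame_splitting B i).
Proof.
move=> Bu; split=> Bp i; last first.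
  by rewrite Bp /frame_splitting !mulmxA mulmxV// mul1mx.
by rewrite /frame_splitting -mulmxA -Bp mulKmx.
Qed.

End Blocks.

(** * Splittings compatible with the same increasing flag *)

Section Triangular.
Variables (F : fieldType) (n N : nat).
Implicit Types (p q : 'I_N -> 'M[F]_n) (I J : {set 'I_N}) (k : nat).

Definition upset k : {set 'I_N} := [set j : 'I_N | (k <= j)%N]%SET.

Lemma upset0 : upset 0 = [set: 'I_N]%SET.
Proof. by apply/finset.setP => j; rewrite !inE. Qed.

Lemma upset_nil k : (N <= k)%N -> upset k = finset.set0.
Proof.
move=> Nk; apply/finset.setP => j; rewrite !inE; apply/negbTE.
by rewrite -ltnNge (leq_trans _ Nk).
Qed.

Lemma psum_upset p (i : 'I_N) :
  psum p (upset i) = p i + psum p (upset i.+1).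
Proof.
rewrite (psumD p _ [set i]%SET) -(psum1 p i); congr (_ + _); congr (psum p _).
  by apply/finset.setP => j; rewrite !inE; case: eqP => [->|];
    rewrite ?leqnn ?andbF.
apply/finset.setP => j; rewrite !inE ltn_neqAle eq_sym; congr (~~ _ && _).
Qed.

(** Descent along the flag of the [upset k]: if membership in one step implies
    membership in the next, then [w] lies in the last one, which is zero. *)
Lemma upset_ind p m (w : 'M[F]_(m, n)) : splitting p ->
  (forall i : 'I_N, w *m psum p (upset i) = w ->
    w *m psum p (upset i.+1) = w) -> w = 0.
Proof.
move=> p_split wS; have wk k : w *m psum p (upset k) = w.
  elim: k => [|k IHk].
    by rewrite upset0 (psumT p_split) mulmx1.
  have [kN|Nk] := ltnP k N; first exact: (wS (Ordinal kN)).
  by rewrite -[RHS]IHk !upset_nil// ltnW.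
by rewrite -(wk N) upset_nil// psum0 mulmx0.
Qed.

(** [psum p I] and [psum q I] have the same image. *)
Definition same_flag p q I : Prop :=
  psum p I *m psum q I = psum p I /\ psum q I *m psum p I = psum q I.

Section Transversality.
Variables p q : 'I_N -> 'M[F]_n.
Hypotheses (p_split : splitting p) (q_split : splitting q).
Hypothesis pq_up : forall k, same_flag p q (upset k).

(** Two splittings with the same flag have the same summand of index [i] modulo
    the following ones.  Hence the leading component of a vector of the sum of
    the [q]-summands over [J] has its index in [J], and a vector of the
    complementary sum of [p]-summands cannot have such a component. *)
Lemma transversal m (w : 'M[F]_(m, n)) J :
  w *m psum q J = w -> w *m psum p (~: J) = w -> w = 0.
Proof.
move=> wq wp; apply: (upset_ind p_split) => i wi.
have [iJ|iJ] := boolP (i \in J).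
  rewrite -[RHS]wi psum_upset mulmxDr -[w in w *m p i]wp -mulmxA psum_mulmx//.
  by rewrite inE iJ mulmx0 add0r.
have wiq : w *m psum q (upset i) = w.
  by rewrite -wi -mulmxA (pq_up i).1.
have {wiq}wiq : w *m psum q (upset i.+1) = w.
  rewrite -[RHS]wiq psum_upset mulmxDr -[w in w *m q i]wq -mulmxA psum_mulmx//.
  by rewrite (negPf iJ) mulmx0 add0r.
by rewrite -wiq -mulmxA (pq_up _).2.
Qed.

(** Sends [v] to the sum of its [q]-component on [J] and its [p]-component off
    [J].  If [S] is this matrix, then [invmx S *m psum q J] and
    [invmx S *m psum p (~: J)] are the two projectors of the mixed decomposition
    of the space which transversality provides. *)
Definition switch_mx J : 'M[F]_n := psum q J + psum p (~: J).

Lemma switch_unit J : switch_mx J \in unitmx.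
Proof.
apply: unitmx_row0 => v; rewrite mulmxDr => /eqP; rewrite addr_eq0 => /eqP vS.
have vq0 : v *m psum q J = 0.
  apply: (@transversal _ _ J).
    by rewrite -mulmxA psumMl.
  by rewrite vS mulNmx -mulmxA psumMl.
have vp0 : v *m psum p (~: J) = 0 by rewrite -[LHS]opprK -vS vq0 oppr0.
apply: (@transversal _ _ (~: J)).
  by rewrite -{2}[v]mulmx1 -(psumC q_split J) mulmxDr vq0 add0r.
by rewrite finset.setCK -{2}[v]mulmx1 -(psumC p_split J) mulmxDr vp0 addr0.
Qed.

End Transversality.

(** An injective map which sends the image of [e] into itself sends it onto
    itself, for reasons of dimension; thus so does its inverse. *)
Lemma stable_invmx (e S : 'M[F]_n) : e *m e = e -> S \in unitmx ->
  e *m S *m e = e *m S -> e *m invmx S *m e = e *m invmx S.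
Proof.
move=> ee Su eSe.
have eS : (e *m S <= e)%MS by rewrite -eSe submxMl.
have /submxP[X eX] : (e <= e *m S)%MS.
  by rewrite -(mxrank_leqif_sup eS) mxrankMfree// row_free_unit.
have -> : e *m invmx S = X *m e by rewrite {1}eX -!mulmxA mulmxV// mulmx1.
by rewrite -mulmxA ee.
Qed.

Lemma fixvs_le_mulmx (P Q : 'M[F]_n) : P *m P = P ->
  (fixvs P <= fixvs Q)%VS -> P *m Q = P.
Proof.
move=> PP /subvP PQ; apply/row_matrixP => i; rewrite row_mul.
by apply/fixvsP/PQ/fixvsP; rewrite -row_mul PP.
Qed.

Lemma same_flag_fixvs p q I : splitting p -> splitting q ->
  fixvs (psum p I) = fixvs (psum q I) -> same_flag p q I.
Proof.
move=> p_split q_split pq.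
by split; apply: fixvs_le_mulmx; rewrite ?psumMl// pq.
Qed.

End Triangular.

(** * Triangular homomorphisms and graphs *)

Section HomSpace.
Variables (F : fieldType) (n N : nat).
Implicit Types (p q : 'I_N -> 'M[F]_n) (J K W : 'I_N -> {set 'I_N}).

(** The endomorphisms which send the summand [i] into the sum of those with
    index in [W i]. *)
Definition homspace p W : {vspace 'M[F]_n} :=
  fixedSpace (\sum_i linfun (mulmxr (psum p (W i)) \o mulmx (p i))).

Lemma homspaceP p W (A : 'M[F]_n) : splitting p ->
  reflect (forall i, p i *m A *m psum p (W i) = p i *m A) (A \in homspace p W).
Proof.
move=> p_split; apply: (iffP fixedSpaceP) => [|AW]; rewrite sum_lfunE.
  under eq_bigr do rewrite lfunE/=.
  move=> AE i; rewrite -[in RHS]AE [RHS]mulmx_sumr [RHS](bigD1 i)//=.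
  rewrite big1 => [|j ji].
    by rewrite addr0 !mulmxA p_split.1 eqxx.
  by rewrite !mulmxA p_split.1 eq_sym (negPf ji) !mul0mx.
under eq_bigr do rewrite lfunE/= AW.
by rewrite -row_psum.
Qed.

(** [A] moves every summand into later ones, so it is nilpotent. *)
Lemma homspace_unipotent p W (A : 'M[F]_n) : splitting p ->
  (forall i : 'I_N, W i \subset upset N i.+1) -> A \in homspace p W ->
  1%:M + A \in unitmx.
Proof.
move=> p_split Wup /(homspaceP W A p_split) AW.
have Aup k : psum p (upset N k) *m A *m psum p (upset N k.+1) =
    psum p (upset N k) *m A.
  rewrite !mulmx_suml; apply: eq_bigr => i; rewrite inE => ki.
  rewrite -AW -mulmxA psumMl//; apply: fintype.subset_trans (Wup i) _.
  by apply/fintype.subsetP => j; rewrite !inE; apply: leq_ltn_trans.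
apply: unitmx_row0 => v; rewrite mulmxDr mulmx1 => /eqP.
rewrite addr_eq0 => /eqP vA; apply: (upset_ind p_split) => i vi.
have vE : v = - (v *m (psum p (upset N i) *m A)) by rewrite mulmxA vi.
by rewrite {1}vE [in RHS]vE mulNmx -[in LHS]mulmxA Aup.
Qed.

Section Chart.
Variables (p q : 'I_N -> 'M[F]_n) (J : 'I_N -> {set 'I_N}).
Hypotheses (p_split : splitting p) (q_split : splitting q).
Hypothesis pq_up : forall k, same_flag p q (upset N k).

(** The only matrix whose graph over the [p]-summand [i] is contained in the sum
    of the [q]-summands over [J i], and which moves this summand into the sum of
    those with index outside [J i].  Writing it with an inverse matrix makes it
    depend on [p] and [q] in a locally Lipschitz way. *)
Definition chart : 'M[F]_n :=
  - \sum_i p i *m invmx (switch_mx p q (J i)) *m psum p (~: J i).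

Lemma mulmx_chart i :
  p i *m chart = - (p i *m invmx (switch_mx p q (J i)) *m psum p (~: J i)).
Proof.
rewrite /chart mulmxN mulmx_sumr (bigD1 i)//= big1 => [|j ji].
  by rewrite addr0 !mulmxA p_split.1 eqxx.
by rewrite !mulmxA p_split.1 eq_sym (negPf ji) !mul0mx.
Qed.

Lemma chart_graph i : p i *m (1%:M + chart) =
  p i *m invmx (switch_mx p q (J i)) *m psum q (J i).
Proof.
have Su := switch_unit p_split q_split pq_up (J i).
rewrite mulmxDr mulmx1 mulmx_chart -{1}(mulmxKV Su (p i)).
by rewrite [X in _ *m X - _]/switch_mx mulmxDr addrK.
Qed.

(** The difference of two solutions sends the summand [i] into both factors of
    the mixed decomposition. *)
Lemma chart_unique A :
  (forall i, p i *m A *m psum p (~: J i) = p i *m A) ->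
  (forall i, p i *m (1%:M + A) *m psum q (J i) = p i *m (1%:M + A)) ->
  A = chart.
Proof.
move=> AJ AG; apply/eqP; rewrite -subr_eq0; apply/eqP.
rewrite (row_psum p_split (A - chart)) big1// => i _.
apply: (transversal p_split q_split pq_up (J := J i)).
  have -> : p i *m (A - chart) = p i *m (1%:M + A) - p i *m (1%:M + chart).
    by rewrite -mulmxBr opprD addrACA subrr add0r.
  rewrite mulmxBl AG chart_graph; congr (_ - _).
  by rewrite -[LHS]mulmxA psumMl.
rewrite mulmxBr mulmxBl AJ mulmx_chart mulNmx; congr (_ - - _).
by rewrite -[LHS]mulmxA psumMl.
Qed.

(** The matrices [switch_mx p q (J i)] preserve the sum of the summands over
    [K i], so their inverses do too, and the chart does not leave it. *)
Lemma chart_homspace K :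
  (forall i, i \in K i) -> (forall i, J i \subset K i) ->
  (forall i, same_flag p q (K i)) ->
  chart \in homspace p (fun i => K i :\: J i).
Proof.
move=> iK JK pqK; apply/(homspaceP _ _ p_split) => i.
have Su := switch_unit p_split q_split pq_up (J i).
have [pq qp] := pqK i; set e := psum p (K i).
have ee : e *m e = e by rewrite psumMl.
have stab : e *m switch_mx p q (J i) *m e = e *m switch_mx p q (J i).
  rewrite mulmxDr mulmxDl; congr (_ + _); last first.
    by rewrite /e !psumM// finset.setIAC finset.setIid.
  rewrite -mulmxA; congr (_ *m _).
  by rewrite -(psumMl q_split (JK i)) -mulmxA qp.
have {stab} := stable_invmx ee Su stab.
move=> /(congr1 (mulmx (p i))); rewrite !mulmxA.
rewrite (mulmx_psum p_split) iK => stab.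
rewrite mulmx_chart finset.setDE mulNmx; congr (- _).
rewrite -[LHS]mulmxA psumM// finset.setICA finset.setIid -psumM// mulmxA.
by rewrite stab.
Qed.

End Chart.
End HomSpace.

(** * Coordinates on the space of triangular homomorphisms *)

Section HomSpaceFrame.
Variables (F : fieldType) (n N : nat) (blk : 'I_n -> 'I_N).
Variable W : 'I_N -> {set 'I_N}.
Implicit Types (B M : 'M[F]_n).

Definition entries : pred ('I_n * 'I_n) :=
  [pred ab | blk ab.2 \in W (blk ab.1)].

Definition fill (a : 'rV[F]_#|entries|) : 'M[F]_n :=
  \sum_s a 0 s *: delta_mx (enum_val s).1 (enum_val s).2.

Definition pick_entries M : 'rV[F]_#|entries| :=
  \row_s M (enum_val s).1 (enum_val s).2.

Lemma fillE a i j :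
  fill a i j = \sum_s a 0 s * (enum_val s == (i, j))%:R.
Proof.
rewrite /fill summxE; apply: eq_bigr => s _; rewrite !mxE.
rewrite -[enum_val s == _]/(_ && _) /=.
by rewrite ![(_.1 == _)]eq_sym ![(_.2 == _)]eq_sym.
Qed.

Lemma fillK : cancel fill pick_entries.
Proof.
move=> a; apply/rowP => s; rewrite mxE fillE (bigD1 s)//= -surjective_pairing.
rewrite eqxx mulr1 big1 ?addr0// => t ts.
by rewrite (inj_eq enum_val_inj) (negPf ts) mulr0.
Qed.

Lemma fill_notin a i j : (i, j) \notin entries -> fill a i j = 0.
Proof.
move=> ij; rewrite fillE big1// => s _.
by case: eqP => [sij|_]; rewrite ?mulr0//; rewrite -sij enum_valP in ij.
Qed.

Lemma pick_entriesK M :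
  (forall i j, (i, j) \notin entries -> M i j = 0) ->
  fill (pick_entries M) = M.
Proof.
move=> M0; apply/matrixP => i j.
have [ij|ij] := boolP ((i, j) \in entries); last by rewrite fill_notin ?M0.
rewrite fillE (bigD1 (enum_rank_in ij (i, j)))//= enum_rankK_in// eqxx mulr1.
rewrite big1 ?addr0 => [|s sij].
  by rewrite mxE enum_rankK_in.
case: eqP => [sij'|_]; rewrite ?mulr0//.
by case/eqP: sij; rewrite -(enum_valK_in ij s) sij'.
Qed.

(** In block form the condition says which entries may be nonzero. *)
Lemma homspace_block M :
  reflect (forall i j, (i, j) \notin entries -> M i j = 0)
          (M \in homspace (blockproj F blk) W).
Proof.
apply: (iffP (homspaceP _ _ (@block_splitting F _ _ blk))) => [MW a b ab|M0 i].
  have /matrixP/(_ a b) := MW (blk a); rewrite psum_block.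
  rewrite /blockproj !mul_diag_mx mul_mx_diag !mxE eqxx !mul1r.
  rewrite -[RHS]/(M a b) => <-.
  by rewrite (negPf ab : (_ \in W _) = false) mulr0.
rewrite psum_block /blockproj !mul_diag_mx mul_mx_diag.
apply/matrixP => a b; rewrite !mxE; case: eqP => [<-|_]; last by rewrite !mul0r.
have [ab|ab] := boolP ((a, b) \in entries).
  by rewrite [_ \in W _]ab mulr1.
by rewrite (M0 _ _ ab) mulr0 mul0r.
Qed.

Lemma homspace_frame B M : B \in unitmx ->
  (M \in homspace (frame_splitting blk B) W) =
  (B *m M *m invmx B \in homspace (blockproj F blk) W).
Proof.
move=> Bu; apply/(homspaceP _ _ (frame_splittingP _ Bu))
  /(homspaceP _ _ (@block_splitting F _ _ blk)).
  move=> MW i; have := congr1 (fun X => B *m X *m invmx B) (MW i).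
  by rewrite psum_frame /frame_splitting !mulmxA !mulmxK// mulmxV// mul1mx.
move=> MW i; have := congr1 (fun X => invmx B *m X *m B) (MW i).
by rewrite psum_frame /frame_splitting !mulmxA mulmxKV.
Qed.

Definition hom_of_coords B a : 'M[F]_n := invmx B *m fill a *m B.
Definition coords_of_hom B M : 'rV[F]_#|entries| :=
  pick_entries (B *m M *m invmx B).

Lemma hom_of_coords_linear B : linear (hom_of_coords B).
Proof.
move=> c a b; rewrite /hom_of_coords.
rewrite scalemxAl -mulmxDl scalemxAr -mulmxDr; congr (_ *m _ *m _).
rewrite /fill scaler_sumr -big_split/=; apply: eq_bigr => s _.
by rewrite !mxE scalerDl scalerA.
Qed.

Lemma hom_of_coordsP B a : B \in unitmx ->
  hom_of_coords B a \in homspace (frame_splitting blk B) W.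
Proof.
move=> Bu; rewrite homspace_frame// /hom_of_coords !mulmxA mulmxK// mulmxV//.
by rewrite mul1mx; apply/homspace_block => i j; exact: fill_notin.
Qed.

Lemma hom_of_coordsK B : B \in unitmx ->
  cancel (hom_of_coords B) (coords_of_hom B).
Proof.
move=> Bu a; rewrite /coords_of_hom /hom_of_coords !mulmxA mulmxK// mulmxV//.
by rewrite mul1mx fillK.
Qed.

Lemma coords_of_homK B : B \in unitmx ->
  {in homspace (frame_splitting blk B) W,
    cancel (coords_of_hom B) (hom_of_coords B)}.
Proof.
move=> Bu M; rewrite homspace_frame// => /homspace_block M0.
by rewrite /hom_of_coords pick_entriesK// !mulmxA mulVmx// mul1mx mulmxKV.
Qed.

Lemma dim_homspace B : B \in unitmx ->
  \dim (homspace (frame_splitting blk B) W) = #|entries|.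
Proof.
move=> Bu; apply: dim_coords (hom_of_coords_linear B) _ (hom_of_coordsK Bu) _.
  by move=> a; exact: hom_of_coordsP.
exact: coords_of_homK.
Qed.

End HomSpaceFrame.

(** * Orthogonal and oblique projectors *)

Section OrthogonalProjection.
Variables (R : realType) (n : nat).
Implicit Types (U V : {vspace 'rV[R]_n}) (Q : 'M[R]_n).

Lemma fixvs_orthoproj U : fixvs (orthoproj U) = U.
Proof.
apply/vspaceP => v; rewrite [RHS]orthoprojP; apply/idP/idP.
  by move/fixvsP/eqP.
by move/eqP/fixvsP.
Qed.

Lemma orthoproj_idem U : orthoproj U *m orthoproj U = orthoproj U.
Proof.
apply/row_matrixP => i; rewrite row_mul; apply/eqP; rewrite -orthoprojP.
by rewrite /orthoproj row_mul mul_basis_mx_in.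
Qed.

Lemma trmx_orthoproj U : (orthoproj U)^T = orthoproj U.
Proof.
by rewrite /orthoproj/= !trmx_mul trmx_inv trmx_mul !trmxK mulmxA.
Qed.

Lemma orthoproj_sub U V : (U <= V)%VS ->
  orthoproj U *m orthoproj V = orthoproj U.
Proof.
move=> UV; apply: fixvs_le_mulmx; first exact: orthoproj_idem.
by rewrite !fixvs_orthoproj.
Qed.

Lemma dot_ge0 (v : 'rV[R]_n) : 0 <= (v *m v^T) 0 0.
Proof. by rewrite mxE sumr_ge0// => i _; rewrite mxE -expr2 sqr_ge0. Qed.

Lemma dot_eq0 (v : 'rV[R]_n) : (v *m v^T) 0 0 = 0 -> v = 0.
Proof.
rewrite mxE => /eqP; rewrite psumr_eq0 => [/allP v0|i _]; last first.
  by rewrite mxE -expr2 sqr_ge0.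
apply/rowP => i; apply/eqP; have := v0 i (mem_index_enum _).
by rewrite !mxE -expr2 sqrf_eq0.
Qed.

(** The square of [S = Q + Q^T - 1] is [1 + D *m D^T], where [D = Q - Q^T]; so
    [v *m S = 0] implies [|v|^2 + |v *m D|^2 = 0]. *)
Lemma oblique_unit Q : Q *m Q = Q -> Q + Q^T - 1%:M \in unitmx.
Proof.
move=> QQ; have QQT : Q^T *m Q^T = Q^T by rewrite -trmx_mul QQ.
apply: unitmx_row0 => v v0.
have sqE : (Q + Q^T - 1%:M) *m (Q + Q^T - 1%:M) =
    1%:M + (Q - Q^T) *m (Q - Q^T)^T.
  rewrite [(Q - Q^T)^T]linearB/= trmxK !(mulmxBl, mulmxBr, mulmxDl, mulmxDr).
  rewrite !(mulmx1, mul1mx) QQ QQT.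
  move: (Q *m Q^T) (Q^T *m Q) => X Y.
  by apply/matrixP => i j; rewrite !mxE; ring.
apply: dot_eq0; set D := Q - Q^T in sqE.
have : (v *m v^T) 0 0 + (v *m D *m (v *m D)^T) 0 0 = 0.
  have : v *m ((Q + Q^T - 1%:M) *m (Q + Q^T - 1%:M)) = 0.
    by rewrite mulmxA v0 mul0mx.
  rewrite sqE mulmxDr mulmx1 => /(congr1 (fun w => (w *m v^T) 0 0)).
  by rewrite mulmxDl mul0mx mxE [in X in _ = X -> _]mxE trmx_mul !mulmxA.
by move=> /eqP; rewrite paddr_eq0 ?dot_ge0// => /andP[/eqP].
Qed.

(** A formula for the orthogonal projector onto the image of an oblique one,
    which turns Lipschitz estimates for projectors of any kind into estimates
    for the distance of Grassmannians.  It follows from [P Q = P] and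
    [P Q^T = Q^T]. *)
Lemma orthoproj_oblique Q : Q *m Q = Q ->
  orthoproj (fixvs Q) = Q^T *m invmx (Q + Q^T - 1%:M).
Proof.
move=> QQ; set P := orthoproj _.
have PQ : P *m Q = P.
  by apply: fixvs_le_mulmx; rewrite ?orthoproj_idem ?fixvs_orthoproj.
have QP : Q *m P = Q by apply: fixvs_le_mulmx; rewrite ?fixvs_orthoproj.
have PQT : P *m Q^T = Q^T by rewrite -[P]trmx_orthoproj -trmx_mul QP.
apply/(canRL (mulmxK (oblique_unit QQ))).
by rewrite mulmxBr mulmxDr mulmx1 PQ PQT addrAC subrr add0r.
Qed.

End OrthogonalProjection.

(** * Admissible topologies *)

Section Opens.
Variables (N : nat) (T : finTopology N).

Lemma open_atoms (I : {set 'I_N}) :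
  (forall i, i \in I -> atom T i \subset I) -> I \in opens T.
Proof.
move=> TI; have -> : I = (\bigcup_(i in I) atom T i)%SET.
  apply/eqP; rewrite finset.eqEsubset; apply/andP; split.
    by apply/fintype.subsetP => i iI; apply/finset.bigcupP; exists i;
      rewrite ?mem_atom.
  by apply/finset.bigcupsP => i; exact: TI.
apply: (big_ind (fun J => J \in opens T)) => [|J K|i _].
- exact: Defs.open0.
- exact: openU_subproof.
- exact: atom_open.
Qed.

Hypothesis admT : admissible T.

Lemma upset_open k : upset N k \in opens T.
Proof.
apply: open_atoms => i; rewrite inE => ki; apply/fintype.subsetP => j /admT ij.
by rewrite inE (leq_trans ki).
Qed.

Lemma open_rem_min (I : {set 'I_N}) (i : 'I_N) : I \in opens T ->
  (forall j, j \in I -> (i <= j)%N) -> I :\ i \in opens T.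
Proof.
move=> TI imin; apply: open_atoms => j; rewrite !inE => /andP[ji jI].
apply/fintype.subsetP => k kj.
rewrite !inE (fintype.subsetP (atom_min TI jI))//.
rewrite andbT; apply: contra_neq ji => ki; apply/val_inj/eqP => /=.
by rewrite eqn_leq imin// andbT -ki admT.
Qed.

Lemma atom_rem_open i : atom T i :\ i \in opens T.
Proof. by apply: open_rem_min => [|j]; [exact: atom_open|exact: admT]. Qed.

End Opens.

(** The index set is identified with the disjoint union of the ['I_(d i)]. *)
Lemma exists_blocks (N n : nat) (d : 'I_N -> nat) : (\sum_i d i)%N = n ->
  exists blk : 'I_n -> 'I_N,
    forall f : 'I_N -> nat, (\sum_a f (blk a) = \sum_i d i * f i)%N.
Proof.
move=> dn; pose J : finType := {i : 'I_N & 'I_(d i)}.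
have sumJ (f : 'I_N -> nat) : (\sum_(s : J) f (tag s) = \sum_i d i * f i)%N.
  rewrite -(@sig_big_dep _ _ _ 'I_N (fun i => 'I_(d i)) xpredT (fun=> xpredT)
    (fun i _ => f i))/=.
  by apply: eq_bigr => i _; rewrite sum_nat_const card_ord.
have Jn : #|J| = n.
  rewrite -sum1_card (sumJ (fun=> 1)%N) -dn.
  by apply: eq_bigr => i _; rewrite muln1.
rewrite -{}Jn; exists (fun a => tag (enum_val a)) => f.
by rewrite -sumJ [RHS](reindex_onto enum_val enum_rank)//= => [|s _];
  [apply: eq_bigl => a; rewrite enum_valK eqxx|rewrite enum_rankK].
Qed.

(** * The canonical splitting of a configuration *)

Section Configurations.
Variables (R : realType) (n N : nat) (d : 'I_N -> nat) (blk : 'I_n -> 'I_N).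
Hypothesis blkE :
  forall f : 'I_N -> nat, (\sum_a f (blk a) = \sum_i d i * f i)%N.

Lemma card_blk (I : {set 'I_N}) :
  #|[pred a | blk a \in I]| = (\sum_(i in I) d i)%N.
Proof.
rewrite -sum1_card big_mkcond/= (blkE (fun i => (i \in I) : nat)).
rewrite [RHS]big_mkcond; apply: eq_bigr => i _.
by case: ifP; rewrite ?muln1 ?muln0.
Qed.

Lemma sum_block_dims : (\sum_i d i)%N = n.
Proof.
rewrite -[RHS]card_ord -sum1_card (blkE (fun=> 1)%N).
by apply: eq_bigr => i _; rewrite muln1.
Qed.

Section FrameConfig.
Variables (T : finTopology N) (B : 'M[R]_n).
Hypothesis Bu : B \in unitmx.

Lemma frame_config_subproof : is_config d
  [ffun I : openSet T => fixvs (psum (frame_splitting blk B) (sval I))].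
Proof.
have p_split := frame_splittingP blk Bu.
apply/and3P; split; apply/forallP => I; last 2 first.
- by apply/forallP => J; rewrite !ffunE fixvs_psumU.
- by apply/forallP => J; rewrite !ffunE fixvs_psumI.
by rewrite ffunE dim_frame// card_blk.
Qed.

(** Every configuration has this form; the lattice conditions are automatic for
    sums of the summands of one splitting. *)
Definition frame_config : config R n d T := Config frame_config_subproof.

Lemma frame_configE I :
  frame_config I = fixvs (psum (frame_splitting blk B) (sval I)).
Proof. by rewrite ffunE. Qed.

End FrameConfig.

Section SplittingOfConfig.
Variables (T : finTopology N) (x : config R n d T).
Hypothesis admT : admissible T.
Implicit Types I J : {set 'I_N}.

(** Indexed by all subsets, with the default value [0] outside the topology, to
    avoid carrying proofs of openness. *)
Definition config_orthoproj I : 'M[R]_n :=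
  if insub I : option (openSet T) is Some J then orthoproj (x J) else 0.
Local Notation P := config_orthoproj.

Lemma config_orthoprojE (J : openSet T) : P (sval J) = orthoproj (x J).
Proof. by rewrite /config_orthoproj valK. Qed.

Lemma fixvs_config (J : openSet T) : fixvs (P (sval J)) = x J.
Proof. by rewrite config_orthoprojE fixvs_orthoproj. Qed.

Lemma config_orthoproj_sub I J : I \in opens T -> J \in opens T ->
  I \subset J -> P I *m P J = P I.
Proof.
move=> TI TJ IJ; rewrite -[I]/(sval (exist _ I TI : openSet T)).
rewrite -[J]/(sval (exist _ J TJ : openSet T)) !config_orthoprojE.
apply: orthoproj_sub; have /and3P[_ _] := configP x.
move=> /forallP/(_ (exist _ I TI))/forallP/(_ (exist _ J TJ))/eqP.
rewrite (_ : Defs.openI _ _ = exist _ I TI) => [->|]; first exact: capvSr.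
by apply/val_inj => /=; apply/finset.setIidPl.
Qed.

Lemma trmx_config_orthoproj I : (P I)^T = P I.
Proof.
rewrite /config_orthoproj; case: insub => [J|]; last exact: trmx0.
exact: trmx_orthoproj.
Qed.

Lemma dim_fixvs_config I : I \in opens T ->
  \dim (fixvs (P I)) = (\sum_(i in I) d i)%N.
Proof.
move=> TI; rewrite -[P I]/(P (sval (exist _ I TI : openSet T))) fixvs_config.
by have /and3P[/forallP/(_ (exist _ I TI))/eqP] := configP x.
Qed.

Lemma config_orthoprojT : P [set: 'I_N]%SET = 1%:M.
Proof.
have dimP := dim_fixvs_config (Defs.openT T).
have fullP : fixvs (P [set: 'I_N]%SET) = fullv.
  have dim_full : \dim (fullv : {vspace 'rV[R]_n}) = n.
    by rewrite dimvf dim_matrix [LHS]mul1n.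
  apply/eqP; rewrite eqEdim subvf dim_full dimP -[leqLHS]sum_block_dims/=.
  by rewrite leq_eqVlt; apply/orP/or_introl/eqP/eq_bigl => i; rewrite inE.
apply/row_matrixP => i; rewrite -[in LHS](mul1mx (P _)) row_mul.
by apply/fixvsP; rewrite fullP memvf.
Qed.

Lemma config_orthoprojU I J K : I \in opens T -> J \in opens T ->
  K \in opens T -> K = I :|: J -> (P K <= P I + P J)%MS.
Proof.
move=> TI TJ TK KIJ; have /and3P[_ /forallP + _] := configP x.
move=> /(_ (exist _ I TI))/forallP/(_ (exist _ J TJ))/eqP.
rewrite (_ : Defs.openU _ _ = exist _ K TK); last exact: val_inj.
rewrite -!fixvs_config/= => PK; apply/row_subP => i.
have : row i (P K) \in fixvs (P K).
  by apply/fixvsP; rewrite -row_mul config_orthoproj_sub.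
rewrite PK => /memv_addP[u /fixvsP <-] [v /fixvsP <-] ->.
by rewrite addmx_sub_adds// submxMl.
Qed.

(** The orthogonal projector onto the orthogonal complement of [x_(T(i) \ {i})]
    in [x_(T(i))], the [i]-th summand of the canonical splitting. *)
Definition piece i : 'M[R]_n := P (atom T i) - P (atom T i :\ i).

(** Induction on the size of [I]: its least element [i] lies in the atom of no
    other element of [I], so [I \ {i}] is open, and [x_I] is the sum of
    [x_(I \ {i})] and of [x_(T(i))], which in turn is the [i]-th summand plus a
    subspace of [x_(I \ {i})]. *)
Lemma config_orthoproj_pieces I : I \in opens T ->
  (P I <= \sum_(i in I) piece i)%MS.
Proof.
have [m] := ubnP #|I|; elim: m I => // m IHm I Im TI.
have [->|[i0 i0I]] := finset.set_0Vmem I.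
  suff -> : P finset.set0 = 0 by exact: sub0mx.
  have := dim_fixvs_config (Defs.open0 T); rewrite big_set0 => /eqP.
  rewrite dimv_eq0 => /eqP P0; apply/row_matrixP => i; rewrite row0.
  apply/eqP; rewrite -memv0 -P0; apply/fixvsP.
  by rewrite -row_mul config_orthoproj_sub// ?Defs.open0.
case: (arg_minnP (fun i : 'I_N => i : nat) i0I) => i imem imin.
have iI : i \in I := imem.
have TI' := open_rem_min admT TI imin.
have iA := atom_min TI iI.
have IE : I = atom T i :|: (I :\ i).
  apply/finset.setP => j; rewrite !inE; apply/idP/idP => [jI|].
    by rewrite jI andbT; case: eqP => [->|_]; rewrite ?mem_atom ?orbT.
  by move=> /orP[/(fintype.subsetP iA)//|/andP[]].
have PI := config_orthoprojU (atom_open T i) TI' TI IE.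
apply: submx_trans PI _; rewrite addsmx_sub.
have PI' : (P (I :\ i) <= \sum_(j in I) piece j)%MS.
  apply: submx_trans (IHm _ _ TI') _.
    by rewrite (finset.cardsD1 i) iI in Im.
  apply/sumsmx_subP => j; rewrite !inE => /andP[_ jI].
  by rewrite (sumsmx_sup j).
rewrite PI' andbT -[P (atom T i)](subrK (P (atom T i :\ i))) addmx_sub//.
  by rewrite (sumsmx_sup i).
apply: submx_trans PI'.
rewrite -(config_orthoproj_sub (atom_rem_open admT i) TI') ?submxMl//.
exact: finset.setSD.
Qed.

Lemma piece_open i I : I \in opens T -> i \in I -> piece i *m P I = piece i.
Proof.
move=> TI iI; have iA := atom_min TI iI.
rewrite mulmxBl !config_orthoproj_sub ?atom_open ?atom_rem_open//.
exact: fintype.subset_trans (finset.subD1set _ _) iA.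
Qed.

Lemma trmx_piece i : (piece i)^T = piece i.
Proof. by rewrite linearB/= !trmx_config_orthoproj. Qed.

Lemma piece_rem i : piece i *m P (atom T i :\ i) = 0.
Proof.
have TL := atom_rem_open admT i; have TA := atom_open T i.
rewrite mulmxBl [P (_ :\ _) *m _]config_orthoproj_sub//.
have := congr1 trmx (config_orthoproj_sub TL TA (finset.subD1set _ _)).
by rewrite trmx_mul !trmx_config_orthoproj => ->; rewrite subrr.
Qed.

Lemma piece_idem i : piece i *m piece i = piece i.
Proof.
rewrite {2}/piece mulmxBr piece_rem subr0.
by rewrite piece_open ?atom_open ?mem_atom.
Qed.

Lemma dim_piece i : \dim (fixvs (piece i)) = d i.
Proof.
have TL := atom_rem_open admT i; have TA := atom_open T i.
have := dim_fixvs_config TA.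
rewrite (finset.big_setD1 i) ?mem_atom//= -dim_fixvs_config//.
have -> : fixvs (P (atom T i)) =
    (fixvs (piece i) + fixvs (P (atom T i :\ i)))%VS.
  apply/eqP; rewrite eqEsubv; apply/andP; split.
    apply/subvP => v /fixvsP vA.
    have -> : v = v *m piece i + v *m P (atom T i :\ i).
      by rewrite -mulmxDr subrK vA.
    rewrite memv_add//; apply/fixvsP; rewrite -mulmxA ?piece_idem//.
    by rewrite config_orthoproj_sub.
  rewrite subv_add; apply/andP; split; apply: fixvs_sub.
    by rewrite piece_open// mem_atom.
  by rewrite config_orthoproj_sub// finset.subD1set.
rewrite dimv_disjoint_sum; first exact: addIn.
apply/eqP; rewrite -subv0; apply/subvP => v; rewrite memv_cap memv0.
move=> /andP[/fixvsP vi /fixvsP vL].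
by rewrite -vL -vi -mulmxA piece_rem mulmx0.
Qed.

Definition config_gram : 'M[R]_n := \sum_i piece i.

(** [v *m config_gram *m v^T] is the sum of the [|v *m piece i|^2], so a vector
    of the kernel is orthogonal to all summands; but these span the space. *)
Lemma config_gram_unit : config_gram \in unitmx.
Proof.
apply: unitmx_row0 => v v0.
have vi i : v *m piece i = 0.
  apply: dot_eq0; apply/eqP; move: i (erefl true).
  have : \sum_i (v *m piece i *m (v *m piece i)^T) 0 0 = 0.
    have v00 : (v *m config_gram *m v^T) 0 0 = 0 by rewrite v0 mul0mx mxE.
    rewrite -[RHS]v00 /config_gram mulmx_sumr mulmx_suml summxE.
    apply: eq_bigr => i _.
    by rewrite trmx_mul trmx_piece mulmxA -[v *m _ *m piece i]mulmxA piece_idem.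
  move=> /eqP; rewrite psumr_eq0 => [/allP s0 i _|i _]; last exact: dot_ge0.
  exact: (s0 i (mem_index_enum _)).
have := config_orthoproj_pieces (Defs.openT T); rewrite config_orthoprojT.
move=> /sub_sumsmxP[u /(congr1 trmx)]; rewrite trmx1 linear_sum/= => uE.
rewrite -[v]mulmx1 uE mulmx_sumr big1// => i _.
by rewrite trmx_mul trmx_piece mulmxA vi mul0mx.
Qed.

(** As [v = \sum_i v *m invmx config_gram *m piece i], the components of [v] on
    the summands are the terms of this sum.  The formula is rational in the
    orthogonal projectors of the configuration, hence locally Lipschitz. *)
Definition config_splitting i : 'M[R]_n := invmx config_gram *m piece i.

(** The bases of the summands are concatenated; by [dim_piece], the [i]-th one
    has as many vectors as there are indices in the block [i]. *)
Lemma exists_piece_basis : exists B : 'M[R]_n,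
  forall i, (piece i <= blockproj R blk i *m B)%MS.
Proof.
pose E i := fixvs (piece i); pose A i := enum [pred a | blk a \in [set i]%SET].
have sizeA i : size (A i) = \dim (E i).
  by rewrite -cardE card_blk big_set1 dim_piece.
pose B := \matrix_a (vbasis (E (blk a)))`_(index a (A (blk a))).
have rowB i a : row a (blockproj R blk i *m B) =
    if blk a == i then (vbasis (E i))`_(index a (A i)) else 0.
  rewrite mul_diag_mx; apply/rowP => j; rewrite !mxE.
  by case: eqP => [->|_]; rewrite ?mul1r// mul0r mxE.
exists B => i; apply/row_subP => r; have : row r (piece i) \in E i.
  by apply/fixvsP; rewrite -row_mul piece_idem.
move=> /coord_vbasis ->; apply: summx_sub => k _; apply: scalemx_sub.
have dimE : \dim (E i) = #|[pred a | blk a \in [set i]%SET]|.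
  by rewrite -sizeA cardE.
pose a := enum_val (cast_ord dimE k).
have ai : blk a == i by have := enum_valP (cast_ord dimE k); rewrite !inE.
have -> : (vbasis (E i))`_k = row a (blockproj R blk i *m B).
  rewrite rowB ai /a (enum_val_nth a) index_uniq ?enum_uniq//=.
  by rewrite -cardE -dimE.
exact: row_sub.
Qed.

(** The summands span and their dimensions add up to [n], so concatenated bases
    form an invertible matrix; this is where the sum is seen to be direct. *)
Lemma config_splitting_frame : exists2 B : 'M[R]_n, B \in unitmx &
  forall i, config_splitting i = frame_splitting blk B i.
Proof.
have [B pieceB] := exists_piece_basis.
have Bu : B \in unitmx.
  rewrite -row_full_unit -sub1mx -config_orthoprojT.
  apply: submx_trans (config_orthoproj_pieces (Defs.openT T)) _.
  by apply/sumsmx_subP => j _; apply: submx_trans (pieceB j) (submxMl _ _).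
exists B => // i.
apply: (canLR (mulKmx config_gram_unit)).
have pieceF j : piece j *m frame_splitting blk B i =
    if j == i then piece j else 0.
  have /submxP[Y YE] := pieceB j.
  rewrite YE /frame_splitting !mulmxA mulmxK//.
  rewrite -[Y *m blockproj _ _ j *m blockproj _ _ i]mulmxA.
  rewrite (block_splitting _ _).1; case: eqP => [->//|_].
  by rewrite mulmx0 mul0mx.
rewrite mulmx_suml; under eq_bigr do rewrite pieceF.
by rewrite -big_mkcond big_pred1_eq.
Qed.

Lemma config_splittingP : splitting config_splitting.
Proof.
have [B Bu pB] := config_splitting_frame.
by rewrite (_ : config_splitting = frame_splitting blk B);
  [exact: frame_splittingP|exact/funext].
Qed.

Lemma fixvs_config_splitting (I : openSet T) :
  fixvs (psum config_splitting (sval I)) = x I.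
Proof.
have TI := svalP I; have p_split := config_splittingP.
have pieceE i : piece i = config_gram *m config_splitting i.
  by rewrite mulKVmx// config_gram_unit.
rewrite -fixvs_config; apply/eqP; rewrite eqEsubv; apply/andP; split.
  apply: fixvs_sub; rewrite mulmx_suml; apply: eq_bigr => i iI.
  by rewrite -mulmxA piece_open.
apply: fixvs_sub; have /sub_sumsmxP[u uE] := config_orthoproj_pieces TI.
rewrite uE mulmx_suml; apply: eq_bigr => i iI.
by rewrite -mulmxA pieceE -mulmxA mulmx_psum// iI.
Qed.

End SplittingOfConfig.
End Configurations.

(** * Lipschitz estimates for configurations and bundles *)

Section LipschitzMaps.
Variables (R : realType) (X Y : metricType R).

Lemma locally_lipschitz_continuous (f : X -> Y) :
  locally_lipschitz f -> continuous f.
Proof.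
move=> fL x; have [U [xU [k fk]]] := fL x.
apply/metricType_numDomainType.cvgrPdist_lt => e e0.
have k1 : 0 < `|k| + 1 by rewrite ltr_wpDl.
have : \forall y \near x, U y /\ ball x (e / (`|k| + 1)) y.
  by apply: filterI => //; apply: nbhsx_ballx; rewrite divr_gt0.
apply: filterS => y [Uy]; rewrite ballEmdist/= => xy.
rewrite (le_lt_trans (fk x y (nbhs_singleton xU) Uy))//.
rewrite (@le_lt_trans _ _ ((`|k| + 1) * mdist x y))//.
  by rewrite ler_wpM2r ?mdist_ge0// (le_trans (ler_norm _))// lerDl.
by rewrite mulrC -ltr_pdivlMr.
Qed.

End LipschitzMaps.

Section ConfigLipschitz.
Variables (R : realType) (n N : nat) (d : 'I_N -> nat).
Implicit Types T : finTopology N.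

Lemma grassmann_dist_le_config T (x y : config R n d T) I :
  grassmann_dist (x I) (y I) <= mdist x y.
Proof.
rewrite -[leRHS]/(config_dist x y) /config_dist (bigD1 I)//= lerDl.
by rewrite sumr_ge0// => J _; exact: frobenius_ge0.
Qed.

Lemma config_orthoproj_loclip T I (x : config R n d T) :
  loclip_at (fun y : config R n d T => config_orthoproj y I) x.
Proof.
rewrite /config_orthoproj; case: insubP => [J _ _|_]; last exact: loclip_at_cst.
exists setT; split; first exact: filterT.
exists 1 => y z _ _; rewrite mul1r.
exact: le_trans (norm_le_frobenius _) (grassmann_dist_le_config _ _ _).
Qed.

Lemma config_splitting_loclip T i
    (blk : 'I_n -> 'I_N)
    (blkE : forall f : 'I_N -> nat, (\sum_a f (blk a) = \sum_i d i * f i)%N) :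
  admissible T -> forall x,
  loclip_at (fun y : config R n d T => config_splitting y i) x.
Proof.
move=> admT x.
have pieceL j : loclip_at (fun y : config R n d T => piece y j) x.
  by apply: loclip_atB; exact: config_orthoproj_loclip.
apply: loclip_atM => //; apply: loclip_at_invmx.
  by apply: loclip_at_sum => j _; exact: pieceL.
exact: (config_gram_unit blkE).
Qed.

Lemma locally_lipschitz_config (X : metricType R) T (f : X -> config R n d T) :
  (forall I x, loclip_at (fun y => orthoproj (f y I)) x) -> locally_lipschitz f.
Proof.
move=> fL x; have /choice[U] := fun I => fL I x.
move=> /all_and2[xU] /choice[k fk].
exists [set y | forall I, U I y]; split; first exact: filter_forall.
exists (\sum_I Num.sqrt (n * n)%:R * k I) => y z Uy Uz.
rewrite -[leLHS]/(config_dist _ _) /config_dist mulr_suml ler_sum// => I _.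
rewrite (le_trans (frobenius_le_norm _))// -mulrA ler_wpM2l ?sqrtr_ge0//.
exact: (fk I _ _ (Uy I) (Uz I)).
Qed.

Lemma config_proj_lipschitz T T' (TT' : prec T T') (x y : config R n d T) :
  mdist (config_proj TT' x) (config_proj TT' y) <=
  #|{: openSet T'}|%:R * mdist x y.
Proof.
rewrite -[leLHS]/(config_dist _ _) /config_dist mulr_natl -sumr_const.
apply: ler_sum => I _; rewrite !ffunE; exact: grassmann_dist_le_config.
Qed.

End ConfigLipschitz.

Section TotalSpace.
Variables (R : realType) (X : metricType R) (E : normedVectType R).
Variable V : X -> {vspace E}.

Lemma bundle_proj_lipschitz (p q : totalSpace V) :
  mdist (bundle_proj p) (bundle_proj q) <= 1 * mdist p q.
Proof. by rewrite mul1r -[leRHS]/(total_dist p q) /total_dist lerDl. Qed.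

Lemma bundle_vec_loclip (p : totalSpace V) : loclip_at (@bundle_vec R X E V) p.
Proof.
exists setT; split; first exact: filterT; exists 1 => q r _ _.
by rewrite mul1r -[leRHS]/(total_dist q r) /total_dist lerDr mdist_ge0.
Qed.

Lemma locally_lipschitz_total (Y : metricType R) (f : Y -> totalSpace V) k :
  (forall y z,
    mdist (bundle_proj (f y)) (bundle_proj (f z)) <= k * mdist y z) ->
  (forall y, loclip_at (fun z => bundle_vec (f z)) y) -> locally_lipschitz f.
Proof.
move=> fk fL y; have [U [yU [c fc]]] := fL y; exists U; split => //.
exists (k + c) => z w Uz Uw; rewrite -[leLHS]/(total_dist _ _) /total_dist.
by rewrite mulrDl lerD ?fk ?fc.
Qed.

End TotalSpace.

(** * The vector bundle *)

Section Bundle.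
Variables (R : realType) (n N : nat) (d : 'I_N -> nat) (blk : 'I_n -> 'I_N).
Hypothesis blkE :
  forall f : 'I_N -> nat, (\sum_a f (blk a) = \sum_i d i * f i)%N.
Variables T T' : finTopology N.
Hypotheses (admT : admissible T) (admT' : admissible T') (TT' : prec T T').

Local Notation X := (config R n d T).
Local Notation X' := (config R n d T').
Local Notation E := ('M[R]_n : normedVectType R).

Let W i : {set 'I_N} := atom T' i :\: atom T i.

Definition hom_bundle (x : X') : {vspace E} := homspace (config_splitting x) W.

Let W_up i : W i \subset upset N i.+1.
Proof.
apply/fintype.subsetP => j; rewrite !inE => /andP[jT jT'].
rewrite ltn_neqAle admT'// andbT; apply: contraNneq jT => ij.
by rewrite (_ : j = i) ?mem_atom//; exact/val_inj.
Qed.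

Let W_K i : W i \subset atom T' i.
Proof. exact: finset.subsetDl. Qed.

Let W_J i : W i \subset ~: atom T i.
Proof. by apply/fintype.subsetP => j; rewrite !inE => /andP[]. Qed.

Let splitP' (x : X') := config_splittingP blkE x admT'.
Let splitP (y : X) := config_splittingP blkE y admT.

Lemma card_entries : #|entries blk W| =
  (\sum_(i < N) \sum_(j in atom T' i :\: atom T i) d i * d j)%N.
Proof.
rewrite -sum1_card big_mkcond/=.
rewrite -(pair_bigA _ (fun a b => if (blk b \in W (blk a)) then 1 else 0)%N)/=.
rewrite (eq_bigr (fun a => \sum_(j in W (blk a)) d j)%N) => [|a _].
  rewrite (blkE (fun i => \sum_(j in W i) d j)%N).
  by apply: eq_bigr => i _; rewrite big_distrr.
rewrite (blkE (fun j => if j \in W (blk a) then 1 else 0)%N) [RHS]big_mkcond.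
by apply: eq_bigr => j _; case: ifP; rewrite ?muln1 ?muln0.
Qed.

(** The matrix [G x = \sum_i p_i(x0) p_i(x)] sends the summands at [x0] to those
    at [x], and is the identity at [x0]; it carries a frame at [x0] to frames at
    all nearby points. *)
Lemma moving_frame (x0 : X') (B0 : 'M[R]_n) : B0 \in unitmx ->
  (forall i, config_splitting x0 i = frame_splitting blk B0 i) ->
  let B x := B0 *m \sum_i config_splitting x0 i *m config_splitting x i in
  (\forall x \near x0, B x \in unitmx) /\
  (forall x, B x \in unitmx -> loclip_at B x /\
    config_splitting x = frame_splitting blk (B x)).
Proof.
move=> B0u pB0 B; have BL x : loclip_at B x.
  apply: loclip_atM; first exact: loclip_at_cst.
  apply: loclip_at_sum => i _; apply: loclip_atM; first exact: loclip_at_cst.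
  exact: config_splitting_loclip.
have p0 := splitP' x0; split=> [|x Bxu].
  apply: loclip_at_near_unit => //.
  rewrite /B (eq_bigr (config_splitting x0)) => [|i _]; last first.
    by rewrite p0.1 eqxx.
  by rewrite p0.2 mulmx1.
split=> //; apply/funext; apply/(frame_splitting_conj blk _ Bxu) => i.
have p := splitP' x.
have -> : B x *m config_splitting x i =
    B0 *m (config_splitting x0 i *m config_splitting x i).
  rewrite -mulmxA mulmx_suml (bigD1 i)//= big1 => [|j ji].
    by rewrite addr0 -mulmxA p.1 eqxx.
  by rewrite -mulmxA p.1 (negPf ji) mulmx0.
rewrite /B [RHS]mulmxA -((frame_splitting_conj blk _ B0u).2 pB0 i) -[RHS]mulmxA.
congr (_ *m _); rewrite [RHS]mulmx_sumr (bigD1 i)//= big1 => [|j ji].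
  by rewrite addr0 [RHS]mulmxA p0.1 eqxx.
by rewrite mulmxA p0.1 eq_sym (negPf ji) mul0mx.
Qed.

Lemma continuous_fill (k : 'rV[R]_#|entries blk W|) :
  {for k, continuous (@fill R n N blk W)}.
Proof.
apply: (@cvg_mx_entries R _ (nbhs k)) => i j; rewrite fillE.
rewrite (_ : (fun=> _) = fun a : 'rV[R]_#|entries blk W| =>
    \sum_s a 0 s * (enum_val s == (i, j))%:R); last first.
  by apply/funext => a; rewrite fillE.
apply: cvg_big => [|s _]; first exact: add_continuous.
by apply: cvgM; [exact: coord_continuous|exact: cvg_cst].
Qed.

Lemma continuous_pick_entries (M : 'M[R]_n) :
  {for M, continuous (@pick_entries R n N blk W)}.
Proof.
apply: (@cvg_mx_entries R _ (nbhs M)) => i s; rewrite mxE.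
rewrite (_ : (fun=> _) = fun M : 'M[R]_n => M (enum_val s).1 (enum_val s).2).
  exact: coord_continuous.
by apply/funext => A; rewrite mxE.
Qed.

Lemma hom_bundle_vector_bundle : vector_bundle hom_bundle #|entries blk W|.
Proof.
split=> [x|x0].
  have [B Bu pB] := config_splitting_frame blkE x admT'.
  rewrite /hom_bundle (_ : config_splitting x = frame_splitting blk B).
    exact: dim_homspace.
  exact/funext.
have [B0 B0u pB0] := config_splitting_frame blkE x0 admT'.
have := moving_frame B0u pB0; set B := (fun x => B0 *m _) => -[nearB BP].
exists [set x | B x \in unitmx]; split => //.
exists (fun x => @hom_of_coords R n N blk W (B x)),
  (fun x => coords_of_hom blk W (B x)).
have cvgB (Z : topologicalType) (u : X' * Z) : B u.1 \in unitmx ->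
    (fun v : X' * Z => B v.1) @ u --> B u.1 /\
    (fun v : X' * Z => invmx (B v.1)) @ u --> invmx (B u.1).
  move=> Bu; have [BL _] := BP _ Bu; split.
    exact: (cvg_comp _ _ cvg_fst (loclip_at_cvg BL)).
  exact: (cvg_comp _ _ cvg_fst (loclip_at_cvg (loclip_at_invmx BL Bu))).
split=> [x _|x Bxu||].
- exact: hom_of_coords_linear.
- rewrite /hom_bundle (BP x Bxu).2; split.
  + by move=> a; exact: hom_of_coordsP.
  + exact: hom_of_coordsK.
  + exact: coords_of_homK.
- apply: continuous_in_subspaceT => u; rewrite inE/= => Bu.
  have [cB cBV] := cvgB _ u Bu.
  apply: cvg_mulmx => //; apply: cvg_mulmx => //.
  apply: (@cvg_comp _ _ _ snd (@fill R n N blk W) _ (nbhs u.2)).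
    exact: cvg_snd.
  exact: continuous_fill.
- apply: continuous_in_subspaceT => u; rewrite inE/= => -[Bu _].
  have [cB cBV] := cvgB _ u Bu.
  apply: (@cvg_comp _ _ _ (fun v => B v.1 *m v.2 *m invmx (B v.1))
    (@pick_entries R n N blk W) _ (nbhs (B u.1 *m u.2 *m invmx (B u.1))));
    last exact: continuous_pick_entries.
  apply: cvg_mulmx => //; apply: cvg_mulmx => //.
  exact: cvg_snd.
Qed.

(** * The homeomorphism *)

Lemma hom_unipotent (pt : totalSpace hom_bundle) :
  1%:M + bundle_vec pt \in unitmx.
Proof. exact: homspace_unipotent (splitP' _) W_up (totalP pt). Qed.

Lemma graph_frame_subproof (pt : totalSpace hom_bundle) :
  exists2 C : 'M[R]_n, C \in unitmx & forall I,
    psum (frame_splitting blk C) I = invmx (1%:M + bundle_vec pt) *m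
      psum (config_splitting (bundle_proj pt)) I *m (1%:M + bundle_vec pt).
Proof.
have Au := hom_unipotent pt; set A := 1%:M + _ in Au *.
have [B Bu pB] := config_splitting_frame blkE (bundle_proj pt) admT'.
exists (B *m A) => [|I]; first by rewrite unitmx_mul Bu.
rewrite /psum mulmx_sumr mulmx_suml; apply: eq_bigr => i _.
rewrite pB /frame_splitting.
have -> : invmx (B *m A) = invmx A *m invmx B.
  have BAu : B *m A \in unitmx by rewrite unitmx_mul Bu.
  by rewrite -[RHS](mulKmx BAu) -mulmxA (mulKVmx Au) mulmxV// mulmx1.
by rewrite !mulmxA.
Qed.

(** Frames are chosen without any continuity in the base point, which is
    harmless: by [graph_configE] the configuration does not depend on them. *)
Definition graph_frame pt := s2val (cid2 (graph_frame_subproof pt)).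

Lemma graph_frame_unit pt : graph_frame pt \in unitmx.
Proof. exact: (s2valP (cid2 (graph_frame_subproof pt))). Qed.

(** The summand [i] of [x] is replaced by the graph of the restriction of [A] to
    it, that is, by its image under [1 + A]. *)
Definition graph_config (pt : totalSpace hom_bundle) : X :=
  frame_config blkE T (graph_frame_unit pt).

Definition graph_idem (pt : totalSpace hom_bundle) I : 'M[R]_n :=
  invmx (1%:M + bundle_vec pt) *m
    psum (config_splitting (bundle_proj pt)) I *m (1%:M + bundle_vec pt).

Lemma graph_configE pt I : graph_config pt I = fixvs (graph_idem pt (sval I)).
Proof.
rewrite frame_configE /graph_idem.
by rewrite -(s2valP' (cid2 (graph_frame_subproof pt))).
Qed.

Lemma graph_idemM pt I : graph_idem pt I *m graph_idem pt I = graph_idem pt I.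
Proof.
rewrite /graph_idem !mulmxA mulmxK ?hom_unipotent//.
by rewrite -[_ *m psum _ I *m psum _ I]mulmxA psumMl//; exact: splitP'.
Qed.

Lemma config_proj_flag (y : X) I : I \in opens T' ->
  same_flag (config_splitting (config_proj TT' y)) (config_splitting y) I.
Proof.
move=> TI'; apply: same_flag_fixvs => //.
rewrite -[I]/(sval (exist _ I TI' : openSet T')).
rewrite (fixvs_config_splitting blkE _ admT') ffunE.
by rewrite -(fixvs_config_splitting blkE _ admT).
Qed.

Let flag_up (y : X) k : same_flag (config_splitting (config_proj TT' y))
  (config_splitting y) (upset N k).
Proof. exact/config_proj_flag/upset_open. Qed.

(** The inverse construction: the coordinate [A] of [y] in the fiber over its
    projection. *)
Definition config_chart (y : X) : 'M[R]_n :=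
  chart (config_splitting (config_proj TT' y)) (config_splitting y) (atom T).

Lemma config_chart_mem y : config_chart y \in hom_bundle (config_proj TT' y).
Proof.
apply: chart_homspace => // i; first exact: mem_atom.
exact/config_proj_flag/atom_open.
Qed.

Definition bundle_chart (y : X) : totalSpace hom_bundle :=
  @Total R X' E hom_bundle (config_proj TT' y, config_chart y)
    (config_chart_mem y).

(** For [I] in the coarser topology, [A] moves the summands over [I] within
    [x_I], so [1 + A] preserves [x_I]. *)
Lemma config_proj_graph pt : config_proj TT' (graph_config pt) = bundle_proj pt.
Proof.
apply/val_inj/ffunP => I /=; rewrite ffunE graph_configE/=.
set x := bundle_proj pt; have p_split := splitP' x.
rewrite -[RHS](fixvs_config_splitting blkE x admT').
set e := psum _ _; set A := bundle_vec pt.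
have ee : e *m e = e by rewrite psumMl.
have Au : 1%:M + A \in unitmx := hom_unipotent pt.
have AW := elimT (homspaceP _ _ p_split) (totalP pt).
have stab : e *m (1%:M + A) *m e = e *m (1%:M + A).
  rewrite mulmxDr mulmx1 mulmxDl ee; congr (_ + _).
  rewrite !mulmx_suml; apply: eq_bigr => i iI.
  rewrite -AW -mulmxA psumMl//.
  exact: fintype.subset_trans (W_K i) (atom_min (svalP I) iI).
have stabV := stable_invmx ee Au stab.
apply/eqP; rewrite eqEsubv; apply/andP; rewrite /graph_idem.
split; apply: fixvs_sub.
  by rewrite -!mulmxA; congr (_ *m _); rewrite mulmxA stab.
by rewrite !mulmxA stabV mulmxKV.
Qed.

(** Both the given homomorphism and the chart satisfy the conditions of
    [chart_unique]. *)
Lemma graph_configK : cancel graph_config bundle_chart.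
Proof.
move=> pt; have xE := config_proj_graph pt.
have AE : bundle_vec pt = config_chart (graph_config pt).
  have := flag_up (graph_config pt); rewrite /config_chart xE => flag.
  have AW := elimT (homspaceP _ _ (splitP' _)) (totalP pt).
  have Au := hom_unipotent pt.
  apply: chart_unique => // i.
    rewrite -AW -mulmxA psumMl//; exact: splitP'.
  have graph_sub : graph_idem pt (atom T i) *m
      psum (config_splitting (graph_config pt)) (atom T i) =
      graph_idem pt (atom T i).
    apply: fixvs_le_mulmx; first exact: graph_idemM.
    rewrite -[atom T i]/(sval (exist _ (atom T i) (atom_open T i) : openSet T)).
    by rewrite -graph_configE (fixvs_config_splitting blkE _ admT).
  have graph_row :
      config_splitting (bundle_proj pt) i *m (1%:M + bundle_vec pt)
      *m graph_idem pt (atom T i) =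
      config_splitting (bundle_proj pt) i *m (1%:M + bundle_vec pt).
    by rewrite /graph_idem !mulmxA mulmxK// mulmx_psum ?mem_atom.
  by rewrite -[X in X *m psum _ _]graph_row -[LHS]mulmxA graph_sub graph_row.
apply/val_inj; rewrite /= -AE xE /bundle_proj /bundle_vec.
by rewrite -surjective_pairing.
Qed.

(** By [chart_graph] the new subspaces are contained in the given ones, and the
    dimensions agree. *)
Lemma bundle_chartK : cancel bundle_chart graph_config.
Proof.
move=> y; apply/val_inj/ffunP => I /=.
have TI := svalP I.
apply/eqP; rewrite eqEdim; apply/andP; split; last first.
  have /and3P[/forallP/(_ I)/eqP -> _ _] := configP y.
  have := configP (graph_config (bundle_chart y)).
  by case/and3P => /forallP/(_ I)/eqP -> _ _.
rewrite graph_configE -[y I](fixvs_config_splitting blkE y admT).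
apply: fixvs_sub; rewrite /graph_idem -!mulmxA; congr (_ *m _).
rewrite mulmxA !mulmx_suml; apply: eq_bigr => i iI.
rewrite chart_graph//; last exact: flag_up.
by rewrite -mulmxA psumMl// atom_min.
Qed.

Lemma graph_config_lipschitz : locally_lipschitz graph_config.
Proof.
apply: locally_lipschitz_config => I pt.
pose Q := fun q => graph_idem q (sval I).
rewrite (_ : (fun=> _) = fun q => (Q q)^T *m invmx (Q q + (Q q)^T - 1%:M)).
  have AL : loclip_at (fun q : totalSpace hom_bundle => 1%:M + bundle_vec q) pt.
    by apply: loclip_atD; [exact: loclip_at_cst|exact: bundle_vec_loclip].
  have QL : loclip_at Q pt.
    apply: loclip_atM => //; apply: loclip_atM.
      by apply: loclip_at_invmx => //; exact: hom_unipotent.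
    apply: loclip_at_sum => i _.
    apply: (loclip_at_comp (f := fun x => config_splitting x i)
      (@bundle_proj_lipschitz _ _ _ hom_bundle)).
    exact: (config_splitting_loclip _ blkE admT').
  apply: loclip_atM; first exact: loclip_at_trmx.
  apply: loclip_at_invmx; last exact/oblique_unit/graph_idemM.
  apply: loclip_atB; last exact: loclip_at_cst.
  by apply: loclip_atD => //; exact: loclip_at_trmx.
by apply/funext => q; rewrite graph_configE orthoproj_oblique// graph_idemM.
Qed.

Lemma bundle_chart_lipschitz : locally_lipschitz bundle_chart.
Proof.
apply: locally_lipschitz_total => [y z|y]; first exact: config_proj_lipschitz.
have pL i : loclip_at (fun z => config_splitting (config_proj TT' z) i) y.
  apply: (loclip_at_comp (f := fun x => config_splitting x i)
    (config_proj_lipschitz TT')).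
  exact: (config_splitting_loclip _ blkE admT').
apply: loclip_atN; apply: loclip_at_sum => i _.
apply: loclip_atM; last by apply: loclip_at_sum => j _; exact: pL.
apply: loclip_atM; first exact: pL.
apply: loclip_at_invmx; last exact: switch_unit.
apply: loclip_atD; apply: loclip_at_sum => j _; last exact: pL.
exact: (config_splitting_loclip _ blkE admT).
Qed.

End Bundle.

Theorem theorem2p4 (R : realType) (N n : nat) (d : 'I_N -> nat)
    (d_gt0 : forall i, (0 < d i)%N) (sum_d : (\sum_(i < N) d i)%N = n)
    (T T' : finTopology N) (admT : admissible T) (admT' : admissible T')
    (TT' : prec T T') :
  exists (E : normedVectType R) (V : config R n d T' -> {vspace E}),
    vector_bundle V
      (\sum_(i < N) \sum_(j in atom T' i :\: atom T i) d i * d j)%N /\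
    exists (phi : totalSpace V -> config R n d T) (psi : config R n d T -> totalSpace V),
      [/\ homeomorphism phi psi,
          locally_lipschitz phi,
          locally_lipschitz psi &
          forall p : totalSpace V, config_proj TT' (phi p) = bundle_proj p].
Proof.
have [blk blkE] := exists_blocks sum_d.
exists ('M[R]_n : normedVectType R), (@hom_bundle R n N d T T').
split.
  by rewrite -(card_entries blkE); exact: hom_bundle_vector_bundle.
exists (graph_config blkE admT'), (bundle_chart blkE admT admT' TT').
have phiL := @graph_config_lipschitz _ _ _ _ _ blkE T T' admT'.
have psiL := bundle_chart_lipschitz blkE admT admT' TT'.
split => //; last exact: config_proj_graph.
split; [exact: graph_configK|exact: bundle_chartK| |];
  exact: locally_lipschitz_continuous.
Qed.
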